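(* Let $f\in L^2(\mathbb{R}^2)$ be such that $D^{M_1M_2}_{t_1^mt_2^n}f\in L^2(\mathbb{R}^2)$. Then for $k=1,2$, $$\int_{\mathbb{R}^2}|u_k|^2|\mathcal{O}_{M_1M_2}f(u)|^2du\ \int_{\mathbb{R}^2}|t_k|^2|f(t)|^2dt\ \ge\ \left|\frac{b_k}{2}\right|^2\|f\|_2^2 .$$
   Context: For $r=1,2$ let $M_r=(a_r,b_r,c_r,d_r,\tau_r,\eta_r)$ be real parameters with $a_rd_r-b_rc_r=1$ and $b_r\neq 0$. The two-dimensional offset linear canonical transform (2D OLCT) of a function $f$ on $\mathbb{R}^2$, introduced for $f\in L^1(\mathbb{R}^2)$, is $$(\mathcal{O}_{M_1M_2}f)(u)=\int_{\mathbb{R}^2}\mathcal{K}_{M_1}(u_1,t_1)\,\mathcal{K}_{M_2}(u_2,t_2)\,f(t)\,dt,\quad u=(u_1,u_2),\ t=(t_1,t_2),$$ $$\mathcal{K}_{M_r}(u_r,t_r)=\sqrt{\tfrac{1}{2\pi i b_r}}\;\exp\!\Big(\tfrac{i}{2b_r}\big(a_rt_r^2+2t_r(\tau_r-u_r)-2u_r(d_r\tau_r-b_r\eta_r)+d_ru_r^2+d_r\tau_r^2\big)\Big).$$ For nonnegative integers $m,n$ the differential operator $D^{M_1M_2}_{t_1^mt_2^n}$ is $$D^{M_1M_2}_{t_1^mt_2^n}=\Delta^{iM_1}_{t_1^m}\Delta^{iM_2}_{t_2^n},\qquad \Delta^{iM_1}_{t_1^m}=(-1)^m\Big(\frac{\partial}{\partial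 t_1}+\frac{i}{b_1}(a_1t_1+\tau_1)\Big)^m,\qquad \Delta^{iM_2}_{t_2^n}=(-1)^n\Big(\frac{\partial}{\partial t_2}+\frac{i}{b_2}(a_2t_2+\tau_2)\Big)^n .$$ Here $\|f\|_2$ is the $L^2(\mathbb{R}^2)$ norm.
   Formalization: The right-hand side is |b_k/2|² ‖f‖₂⁴ instead of |b_k/2|² ‖f‖₂²: the printed inequality is not homogeneous in f and fails, e.g. for small multiples of a Gaussian under the Fourier transform. *)

(* Defs.v *)
From HB Require Import structures.
From mathcomp Require Import all_boot all_order all_algebra.
From mathcomp Require Import complex.
From mathcomp Require Import all_classical all_reals all_analysis.

Set Implicit Arguments.
Unset Strict Implicit.
Unset Printing Implicit Defensive.
Import Order.TTheory GRing.Theory Num.Theory.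
Import numFieldNormedType.Exports.

Local Open Scope classical_set_scope.
Local Open Scope ring_scope.

Notation mu2 R := (@lebesgue_measure R \x @lebesgue_measure R)%E (only parsing).

Section OLCT.
Context {R : realType}.

Implicit Types (f g phi : R * R -> R[i]) (k : 'I_2).

Definition coordinate k (t : R * R) : R := if k == 0 then t.1 else t.2.

Definition unit_vector k : R * R := if k == 0 then (1, 0) else (0, 1).

Definition cabs (z : R[i]) : R := ComplexField.Normc.normc z.

Definition cexp (z : R[i]) : R[i] :=
  real_complex R (expR (complex.Re z)) *
  (cos (complex.Im z) +i* sin (complex.Im z))%C.

Definition cmeasurable f :=
  measurable_fun [set: R * R] (fun t => complex.Re (f t)) /\
  measurable_fun [set: R * R] (fun t => complex.Im (f t)).

Definition Lpnorm (p : R) f : \bar R :=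
  Lnorm (mu2 R) p%:E (fun t => (cabs (f t))%:E).

Definition in_Lp (p : R) f := cmeasurable f /\ (Lpnorm p f < +oo)%E.

(* Only meaningful when Re f and Im f are both integrable. *)
Definition cintegral f : R[i] :=
  (Rintegral (mu2 R) setT (fun t => complex.Re (f t)) +i*
   Rintegral (mu2 R) setT (fun t => complex.Im (f t)))%C.

Record olct_param := OlctParam {
  pa : R; pb : R; pc : R; pd : R; ptau : R; peta : R }.

(* sqrtc is the principal square root (nonnegative real part). *)
Definition olct_kernel (M : olct_param) (u t : R) : R[i] :=
  let: OlctParam a b c d tau eta := M in
  sqrtc (1 / (real_complex R (2 * pi) * 'i%C * real_complex R b)) *
  cexp ('i%C / real_complex R (2 * b) *
    real_complex R (a * t ^+ 2 + 2 * t * (tau - u)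
                    - 2 * u * (d * tau - b * eta)
                    + d * u ^+ 2 + d * tau ^+ 2)).

(* The integral formula, which defines the transform on L^1. *)
Definition olct_integral (M : 'I_2 -> olct_param) f (u : R * R) : R[i] :=
  cintegral (fun t =>
    olct_kernel (M 0) u.1 t.1 * olct_kernel (M 1) u.2 t.2 * f t).

(* g is (a representative of) the transform of f in L^2, where the transform
   is extended from L^1 `&` L^2 by continuity for the L^2 norm.  The transform
   is an isometry on that dense subspace, so for every f in L^2 such a g exists
   and is unique up to a.e. equality, whichever sequence is used. *)
Definition is_olct (M : 'I_2 -> olct_param) f g :=
  in_Lp 2 g /\
  exists F : nat -> R * R -> R[i],
    [/\ forall n, in_Lp 1 (F n) /\ in_Lp 2 (F n),
        (fun n => Lpnorm 2 (fun t => F n t - f t)) @ \oo --> (0 : \bar R) &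
        (fun n => Lpnorm 2 (fun u => olct_integral M (F n) u - g u)) @ \oo
          --> (0 : \bar R)].

Definition partial k (h : R * R -> R) (t : R * R) : R := 'D_(unit_vector k) h t.

Definition cpartial k phi (t : R * R) : R[i] :=
  (partial k (fun s => complex.Re (phi s)) t +i*
   partial k (fun s => complex.Im (phi s)) t)%C.

(* C^infinity: every iterated partial derivative is differentiable. *)
Definition smooth (h : R * R -> R) :=
  forall (s : seq 'I_2) (t : R * R), differentiable (foldr partial h s) t.

Definition test_function phi :=
  [/\ smooth (fun t => complex.Re (phi t)),
      smooth (fun t => complex.Im (phi t)) &
      compact (closure [set t | phi t != 0])].

(* Distributions are represented by their action on test functions; values
   elsewhere are irrelevant, and the pairing is bilinear (no conjugation). *)
Definition distrib := (R * R -> R[i]) -> R[i].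

Definition regular_distrib f : distrib :=
  fun phi => cintegral (fun t => f t * phi t).

Definition distrib_partial k (T : distrib) : distrib :=
  fun phi => - T (cpartial k phi).

Definition distrib_mul (q : R * R -> R[i]) (T : distrib) : distrib :=
  fun phi => T (fun t => q t * phi t).

(* (-1)^j (d/dt_k + (i / b_k) (a_k t_k + tau_k))^j, in the distributional sense;
   the indices 0, 1 : 'I_2 stand for the subscripts 1, 2. *)
Definition Delta (M : 'I_2 -> olct_param) k (j : nat) (T : distrib) : distrib :=
  let q t := 'i%C / real_complex R (pb (M k)) *
             real_complex R (pa (M k) * coordinate k t + ptau (M k)) in
  fun phi => (-1) ^+ j *
    iter j (fun U psi => distrib_partial k U psi + distrib_mul q U psi) T phi.

Definition Dop (M : 'I_2 -> olct_param) (m n : nat) (T : distrib) : distrib :=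
  Delta M 0 m (Delta M 1 n T).

Definition distrib_in_L2 (T : distrib) :=
  exists2 h, in_Lp 2 h &
    forall phi, test_function phi -> T phi = regular_distrib h phi.

End OLCT.

Arguments olct_param : clear implicits.

(* Main.v *)
Require Import Defs.
From HB Require Import structures.
From mathcomp Require Import all_boot all_order all_algebra.
From mathcomp Require Import complex.
From mathcomp Require Import all_classical all_reals all_analysis.
From mathcomp Require Import measurable_realfun ring lra.

(** This is Heisenberg's inequality, obtained here from translations instead of
    derivatives.

    The exponent of the kernel is a phase in t, a phase in u, and the cross
    term - u t / b of a Fourier kernel.  So, up to a unimodular factor and a
    constant, the transform of f is the Fourier transform, with frequencies
    scaled by 1 / b, of the chirped function phi = exp (i psi) f, and
    |phi| = |f| ([olct_integralE]).

    Translating phi by s along the k-th axis multiplies its transform by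
    exp (i s u_k / b_k), and |exp (i a) - 1| <= |a|.  Plancherel's inequality
    therefore bounds the square norm of phi (. + s e_k) - phi by s ^ 2 E, where
    b_k ^ 2 E is the second moment of the transform
    ([olct_displacement_moment]).  On the other hand the translation lowers the
    first moment of |phi| ^ 2 by exactly s N, where N is the square norm of f.
    Writing s N as the integral of t_k (|phi| ^ 2 - |phi (. + s e_k)| ^ 2),
    factoring the difference of squares, dividing by s and letting s tend to 0
    gives N <= (y / 2) E + 2 D / y for every y > 0, where D is the second moment
    of f; optimizing in y yields N ^ 2 <= 4 D E ([translation_uncertainty]).
    When one of the two second moments vanishes, f vanishes almost everywhere,
    so the product of moments is never of the form 0 times infinity unless
    N = 0.

    Only one half of Plancherel's theorem enters: the square norm of F is at
    most a constant times that of its transform.  It holds for every integrable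
    F, the right-hand side being possibly infinite.  For a real function p on
    the line ([plancherel_le]), the transforms of p and h are paired with the
    Abel weight exp (- e |u|); by Fubini this damped pairing [energy] is the
    integral of p against the Poisson mean of h ([energyE]).  Take for h a
    truncation of p.  The damped energy of p - h is nonnegative, that of p is
    at most the square norm of the transform, that of h is at most K times the
    square norm of h, and the mixed term tends to K times the square norm of h
    by continuity of translations in L1 ([smoothing_defect]).  Hence K times
    the square norm of h is at most the square norm of the transform of p, and
    the truncations increase to p.  Since square integrability is never
    assumed, the inequality in the plane follows by applying the one on the
    line in one variable after the other ([plancherel2_le]).

    The transform of a square integrable function is a limit along some
    sequence of integrable functions; all the estimates pass to the limit by
    [quadratic_limit]. *)

Set Implicit Arguments.
Unset Strict Implicit.
Unset Printing Implicit Defensive.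
Import Order.TTheory GRing.Theory Num.Theory.
Import numFieldNormedType.Exports.
Local Open Scope classical_set_scope.
Local Open Scope ring_scope.

(** * Change of variables, iterated and parametric integrals *)

Section measure_preserving.
Local Open Scope ereal_scope.
Context d (T : measurableType d) (R : realType).
Variables (mu : {measure set T -> \bar R}) (phi : T -> T).
Hypothesis mphi : measurable_fun [set: T] phi.
Hypothesis phi_mu : forall A, measurable A -> mu (phi @^-1` A) = mu A.

(** Invariance is assumed on preimages of measurable sets, so that the same
    lemma serves reflections and translations, on the line and in the plane. *)
Lemma ge0_integral_preserving (f : T -> \bar R) : measurable_fun [set: T] f ->
  (forall x, 0 <= f x) -> \int[mu]_x f (phi x) = \int[mu]_x f x.
Proof.
move=> mf f0; have -> : \int[mu]_x f (phi x) =
    \int[mu]_(x in phi @^-1` setT) (f \o phi) x by rewrite preimage_setT.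
rewrite -ge0_integral_pushforward//.
by apply: eq_measure_integral => A mA _; exact: phi_mu.
Qed.

Lemma integrable_preserving (f : T -> R) : measurable_fun [set: T] f ->
  mu.-integrable setT (EFin \o f) -> mu.-integrable setT (EFin \o (f \o phi)).
Proof.
move=> mf /integrableP[_ fi]; apply/integrableP; split.
  by apply/measurable_EFinP; exact: measurableT_comp.
rewrite (@ge0_integral_preserving (fun x => `|(f x)%:E|))//.
by apply: measurableT_comp => //; exact/measurable_EFinP.
Qed.

Lemma Rintegral_preserving (f : T -> R) : measurable_fun [set: T] f ->
  (\int[mu]_x f (phi x) = \int[mu]_x f x)%R.
Proof.
move=> mf; rewrite /Rintegral integralE [in RHS]integralE.
have mEf : measurable_fun [set: T] (EFin \o f) by exact/measurable_EFinP.
rewrite -(@ge0_integral_preserving (EFin \o f)^\+)//; last exact: measurable_funepos.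
rewrite -(@ge0_integral_preserving (EFin \o f)^\-)//; last exact: measurable_funeneg.
by congr (fine (_ - _)); apply: eq_integral => x _; rewrite ?funeposE ?funenegE.
Qed.

End measure_preserving.

Section lebesgue_motions.
Context {R : realType}.
Local Notation mu := (@lebesgue_measure R).

Lemma measurable_translation (a : R) :
  measurable_fun [set: measurableTypeR R] (fun x : measurableTypeR R => x + a : measurableTypeR R).
Proof. exact: (@measurable_funD _ (measurableTypeR R) R setT id (cst a)). Qed.

Lemma lebesgue_measure_translation (a : R) (A : set (measurableTypeR R)) :
  measurable A -> mu ((fun x : measurableTypeR R => x + a : measurableTypeR R) @^-1` A) = mu A.
Proof.
move=> mA.
pose shift : {mfun measurableTypeR R >-> measurableTypeR R} :=
  HB.pack (fun x : measurableTypeR R => x + a : measurableTypeR R)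
    (isMeasurableFun.Build _ _ _ _ _ (measurable_translation a)).
rewrite (lebesgue_measure_unique (mu := pushforward mu shift) _ mA)//.
move=> _ [[b c]] _ <-.
transitivity (mu `]b - a, c - a]%classic).
  rewrite !lebesgue_measure_itv/= !lte_fin ltrD2r.
  by rewrite -!EFinB opprB addrA subrK.
congr (lebesgue_measure _).
by apply/seteqP; split => x /=; rewrite !in_itv/= ltrBlDr lerBrDr.
Qed.

Lemma lebesgue_measure_reflection (A : set (measurableTypeR R)) :
  measurable A -> mu ((fun x : measurableTypeR R => - x : measurableTypeR R) @^-1` A) = mu A.
Proof. exact: lebesgue_measureN. Qed.

Lemma measurable_opp : measurable_fun [set: measurableTypeR R] (fun x : measurableTypeR R => - x : measurableTypeR R).
Proof. by apply: measurableT_comp. Qed.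

Local Open Scope ereal_scope.

Lemma ge0_integral_translation (a : R) (f : R -> \bar R) :
  measurable_fun [set: measurableTypeR R] f -> (forall x, 0 <= f x) ->
  \int[mu]_x f (x + a)%R = \int[mu]_x f x.
Proof.
move=> mf f0; exact: (ge0_integral_preserving (measurable_translation a)
  (@lebesgue_measure_translation a) mf f0).
Qed.

Lemma ge0_integral_reflection (f : R -> \bar R) :
  measurable_fun [set: measurableTypeR R] f -> (forall x, 0 <= f x) ->
  \int[mu]_x f (- x)%R = \int[mu]_x f x.
Proof.
move=> mf f0; exact: (ge0_integral_preserving measurable_opp
  lebesgue_measure_reflection mf f0).
Qed.

Lemma measurable_translation2 (v : R * R) :
  measurable_fun [set: measurableTypeR R * measurableTypeR R]
    (fun t : measurableTypeR R * measurableTypeR R =>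
      (t + v)%R : measurableTypeR R * measurableTypeR R).
Proof.
apply/measurable_fun_pairP; split.
- by apply: (measurable_funD (f := fst) (g := cst v.1)).
- by apply: (measurable_funD (f := snd) (g := cst v.2)).
Qed.

(** A section of the translated set is a translate of a section, and the
    outer integral absorbs the translation in the other coordinate. *)
Lemma mu2_translation (v : R * R) (A : set (measurableTypeR R * measurableTypeR R)) :
  measurable A ->
  (mu \x mu) ((fun t : measurableTypeR R * measurableTypeR R =>
     (t + v)%R : measurableTypeR R * measurableTypeR R) @^-1` A) = (mu \x mu) A.
Proof.
move=> mA; rewrite /product_measure1 /=.
rewrite -(@ge0_integral_translation v.1 (mu \o xsection A))//; last first.
  exact: measurable_fun_xsection.
apply: eq_integral => x _ /=.
rewrite -(@lebesgue_measure_translation v.2 (xsection A (x + v.1)%R)); last first.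
  exact: measurable_xsection.
by congr (lebesgue_measure _).
Qed.

End lebesgue_motions.

Section parametric_integral.
Context d1 d2 (T1 : measurableType d1) (T2 : measurableType d2) (R : realType).
Variable m2 : {sigma_finite_measure set T2 -> \bar R}.

Lemma measurable_fun_Rintegral (f : T1 * T2 -> R) :
  measurable_fun setT f ->
  measurable_fun setT (fun x => \int[m2]_y f (x, y)).
Proof.
move=> mf; rewrite /Rintegral.
have mEf : measurable_fun setT (EFin \o f) by exact/measurable_EFinP.
apply: (measurableT_comp (f := @fine R)) => //.
have -> : (fun x => \int[m2]_y (f (x, y))%:E)%E = (fun x =>
   \int[m2]_y (EFin \o f)^\+ (x, y) - \int[m2]_y (EFin \o f)^\- (x, y))%E.
  apply/funext => x; rewrite integralE.
  by congr (_ - _)%E; apply: eq_integral => y _; rewrite ?funeposE ?funenegE.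
apply: emeasurable_funB.
- by apply: measurable_fun_fubini_tonelli_F => //; exact: measurable_funepos.
- by apply: measurable_fun_fubini_tonelli_F => //; exact: measurable_funeneg.
Qed.

End parametric_integral.

Section real_fubini.
Context d1 d2 (T1 : measurableType d1) (T2 : measurableType d2) (R : realType).
Variable m1 : {sigma_finite_measure set T1 -> \bar R}.
Variable m2 : {sigma_finite_measure set T2 -> \bar R}.

Lemma measurable_fun_Rintegral_swap (f : T1 * T2 -> R) :
  measurable_fun setT f ->
  measurable_fun setT (fun y => \int[m1]_x f (x, y)).
Proof.
move=> mf; apply: (@measurable_fun_Rintegral _ _ T2 T1 R m1 (f \o (fun z => (z.2, z.1)))).
by apply: measurableT_comp => //; exact: measurable_fun_pair.
Qed.

(** Almost every section is integrable, which is enough to identify the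
    real-valued inner integral with the extended one. *)
Lemma Rintegral_prod1 (f : T1 * T2 -> R) :
  (m1 \x m2)%E.-integrable setT (EFin \o f) ->
  \int[m1]_x (\int[m2]_y f (x, y)) = \int[(m1 \x m2)%E]_z f z.
Proof.
move=> fi; rewrite [in RHS]/Rintegral -(integral12_prod_meas1 fi).
congr fine; have mEf := measurable_int _ fi.
apply: ae_eq_integral => //.
- apply/measurable_EFinP; apply: measurable_fun_Rintegral.
  exact/measurable_EFinP.
- exact: measurable_fubini_F fi.
- apply: filterS (ae_integrable1 fi) => x fxi _.
  by rewrite /Rintegral fineK// integrable_fin_num.
Qed.

Lemma Rintegral_prod2 (f : T1 * T2 -> R) :
  (m1 \x m2)%E.-integrable setT (EFin \o f) ->
  \int[m2]_y (\int[m1]_x f (x, y)) = \int[(m1 \x m2)%E]_z f z.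
Proof.
move=> fi; rewrite [in RHS]/Rintegral -(integral21_prod_meas1 fi).
congr fine; have mEf := measurable_int _ fi.
apply: ae_eq_integral => //.
- apply/measurable_EFinP; apply: measurable_fun_Rintegral_swap.
  exact/measurable_EFinP.
- exact: measurable_fubini_G fi.
- apply: filterS (ae_integrable2 fi) => x fxi _.
  by rewrite /Rintegral fineK// integrable_fin_num.
Qed.

Lemma Rintegral_swap (f : T1 * T2 -> R) :
  (m1 \x m2)%E.-integrable setT (EFin \o f) ->
  \int[m1]_x (\int[m2]_y f (x, y)) = \int[m2]_y (\int[m1]_x f (x, y)).
Proof. by move=> fi; rewrite Rintegral_prod1// Rintegral_prod2. Qed.

Lemma integrable_tensor (f : T1 -> R) (g : T2 -> R) :
  m1.-integrable setT (EFin \o f) -> m2.-integrable setT (EFin \o g) ->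
  (m1 \x m2)%E.-integrable setT (EFin \o (fun z => f z.1 * g z.2)).
Proof.
move=> /integrableP[/measurable_EFinP mf fi] /integrableP[/measurable_EFinP mg gi].
apply/integrable12ltyP.
  apply/measurable_EFinP; apply: measurable_funM.
  - exact: measurableT_comp.
  - exact: measurableT_comp.
under eq_integral => x _.
  under eq_integral => y _ do rewrite /= normrM EFinM.
  rewrite ge0_integralZl//; last first.
    by apply/measurable_EFinP; exact: measurableT_comp.
  over.
rewrite /= ge0_integralZr//; last 2 first.
- by apply/measurable_EFinP; exact: measurableT_comp.
- exact: integral_ge0.
by rewrite lte_mul_pinfty// ?integral_ge0// ge0_fin_numE ?integral_ge0.
Qed.

End real_fubini.

Section integrable_bounded.
Context d (T : measurableType d) (R : realType) (mu : {measure set T -> \bar R}).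

Lemma integrable_EFin_measurable (f : T -> R) :
  mu.-integrable setT (EFin \o f) -> measurable_fun setT f.
Proof. by move=> /integrableP[/measurable_EFinP]. Qed.

Lemma le_integrable_real (f g : T -> R) : measurable_fun setT f ->
  (forall x, `|f x| <= g x) -> mu.-integrable setT (EFin \o g) ->
  mu.-integrable setT (EFin \o f).
Proof.
move=> mf fg gi; apply: le_integrable gi => //; first exact/measurable_EFinP.
by move=> x _ /=; rewrite lee_fin (le_trans (fg x))// ler_norm.
Qed.

Lemma integrable_mul_bounded (f g : T -> R) (M : R) :
  measurable_fun setT g -> (forall x, `|g x| <= M) ->
  mu.-integrable setT (EFin \o f) ->
  mu.-integrable setT (EFin \o (fun x => f x * g x)).
Proof.
move=> mg gM fi; have /integrableP[/measurable_EFinP mf _] := fi.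
have := integrableZl measurableT M fi.
apply: le_integrable => //.
  by apply/measurable_EFinP; exact: measurable_funM.
move=> x _ /=; rewrite lee_fin mulrC !normrM ler_wpM2r//.
by rewrite (le_trans (gM x))// ler_norm.
Qed.

Lemma integrable_EFinD (f g : T -> R) :
  mu.-integrable setT (EFin \o f) -> mu.-integrable setT (EFin \o g) ->
  mu.-integrable setT (EFin \o (fun x => f x + g x)).
Proof. by move=> fi gi; exact: (integrableD measurableT fi gi). Qed.

Lemma integrable_EFinB (f g : T -> R) :
  mu.-integrable setT (EFin \o f) -> mu.-integrable setT (EFin \o g) ->
  mu.-integrable setT (EFin \o (fun x => f x - g x)).
Proof. by move=> fi gi; exact: (integrableB measurableT fi gi). Qed.

Lemma integrable_EFinZ (f : T -> R) (c : R) :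
  mu.-integrable setT (EFin \o f) ->
  mu.-integrable setT (EFin \o (fun x => c * f x)).
Proof. by move=> fi; exact: (integrableZl measurableT c fi). Qed.

Lemma EFin_Rintegral (f : T -> R) : mu.-integrable setT (EFin \o f) ->
  (\int[mu]_x (f x)%:E = (\int[mu]_x f x)%:E)%E.
Proof. by move=> fi; rewrite /Rintegral fineK// integrable_fin_num. Qed.

Lemma le_normr_Rintegral_EFin (f : T -> R) : mu.-integrable setT (EFin \o f) ->
  (`|\int[mu]_x f x|%:E <= \int[mu]_x `|f x|%:E)%E.
Proof.
move=> fi; rewrite EFin_Rintegral; last exact: integrable_abse fi.
by rewrite lee_fin; exact: le_normr_Rintegral.
Qed.

(** If f is not integrable, the right-hand side is infinite. *)
Lemma normr_Rintegral_le
  (f : T -> R) : measurable_fun setT f ->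
  (`|\int[mu]_x f x|%:E <= \int[mu]_x `|f x|%:E)%E.
Proof.
move=> mf; have [foo|] := ltP (\int[mu]_x `|f x|%:E)%E +oo%E; last first.
  by rewrite leye_eq => /eqP ->; exact: leey.
by apply: le_normr_Rintegral_EFin; apply/integrableP; split => //; exact/measurable_EFinP.
Qed.

Lemma Rintegral_ae_eq
  (f g : T -> R) : measurable_fun setT f -> measurable_fun setT g ->
  {ae mu, forall x, f x = g x} -> \int[mu]_x f x = \int[mu]_x g x.
Proof.
move=> mf mg fg; congr fine; apply: ae_eq_integral => //.
- exact/measurable_EFinP.
- exact/measurable_EFinP.
- by apply: filterS fg => x fgx _; congr EFin.
Qed.

Lemma integrable_lt (f : T -> R) : measurable_fun setT f ->
  (forall x, 0 <= f x) -> (\int[mu]_x (f x)%:E < +oo)%E ->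
  mu.-integrable setT (EFin \o f).
Proof.
move=> mf f0 foo; apply/integrableP; split; first exact/measurable_EFinP.
by under eq_integral => x _ do rewrite /= ger0_norm//.
Qed.

End integrable_bounded.

Section nonnegative_real_integrals.
Local Open Scope ereal_scope.
Context d (T : measurableType d) (R : realType) (mu : {measure set T -> \bar R}).
Implicit Types f g : T -> R.

Lemma integral_EFin_ge0 f : (forall x, 0 <= f x)%R -> 0 <= \int[mu]_x (f x)%:E.
Proof. by move=> f0; apply: integral_ge0 => x _; rewrite lee_fin. Qed.

Lemma le_integral_EFin f g :
  measurable_fun setT f -> measurable_fun setT g ->
  (forall x, 0 <= f x)%R -> (forall x, f x <= g x)%R ->
  \int[mu]_x (f x)%:E <= \int[mu]_x (g x)%:E.
Proof.
move=> mf mg f0 fg; apply: ge0_le_integral => //.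
- by move=> x _; rewrite lee_fin.
- exact/measurable_EFinP.
- exact/measurable_EFinP.
- by move=> x _; rewrite lee_fin.
Qed.

Lemma integral_EFinD f g :
  measurable_fun setT f -> measurable_fun setT g ->
  (forall x, 0 <= f x)%R -> (forall x, 0 <= g x)%R ->
  \int[mu]_x (f x + g x)%:E = \int[mu]_x (f x)%:E + \int[mu]_x (g x)%:E.
Proof.
move=> mf mg f0 g0; under eq_integral do rewrite EFinD.
rewrite ge0_integralD//.
- by move=> x _; rewrite lee_fin.
- exact/measurable_EFinP.
- by move=> x _; rewrite lee_fin.
- exact/measurable_EFinP.
Qed.

Lemma integral_EFinZ f (c : R) :
  measurable_fun setT f -> (forall x, 0 <= f x)%R -> (0 <= c)%R ->
  \int[mu]_x (c * f x)%:E = c%:E * \int[mu]_x (f x)%:E.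
Proof.
move=> mf f0 c0; under eq_integral do rewrite EFinM.
rewrite ge0_integralZl//.
- exact/measurable_EFinP.
- by move=> x _; rewrite lee_fin.
Qed.

Lemma integral_EFin_eq0 f : measurable_fun setT f -> (forall x, 0 <= f x)%R ->
  \int[mu]_x (f x)%:E = 0 -> {ae mu, forall x, f x = 0%R}.
Proof.
move=> mf f0 If; have mEf : measurable_fun setT (EFin \o f).
  exact/measurable_EFinP.
have /(ae_eq_integral_abs mu measurableT mEf) :
    \int[mu]_x `|(EFin \o f) x| = 0.
  by rewrite -[RHS]If; apply: eq_integral => x _ /=; rewrite ger0_norm.
by apply: filterS => x /(_ I)/= [].
Qed.

Lemma ge0_integral_scale_le (K : R) (G H : T -> \bar R) : (0 <= K)%R ->
  measurable_fun setT G -> measurable_fun setT H ->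
  (forall x, (0 <= G x)) -> (forall x, (0 <= H x)) ->
  {ae mu, forall x, (K%:E * G x <= H x)} ->
  (K%:E * \int[mu]_x G x <= \int[mu]_x H x).
Proof.
move=> K0 mG mH G0 H0 KGH; rewrite -ge0_integralZl//.
apply: ae_ge0_le_integral => //.
- by move=> x _; apply: mule_ge0; [rewrite lee_fin|exact: G0].
- exact: measurable_funeM.
- by apply: filterS KGH => x KG _.
Qed.

End nonnegative_real_integrals.

Lemma cvge0_lt (R : realType) (f : nat -> \bar R) (e : R) :
  f n @[n --> \oo] --> 0%E -> 0 < e ->
  \forall n \near \oo, (f n < e%:E)%E.
Proof.
move=> f0 e0; apply: (f0 [set x | (x < e%:E)%E]).
by apply: open_nbhs_nbhs; split; [exact: open_ereal_lt_ereal|rewrite /= lte_fin].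
Qed.

(** * The Abel weight and the Poisson kernel *)

Section poisson_kernel.
Context {R : realType}.
Local Notation mu := (@lebesgue_measure R).

Lemma continuous_measurable (f : R -> R) :
  continuous f -> measurable_fun [set: measurableTypeR R] f.
Proof. by move=> cf; have := continuous_measurable_fun cf. Qed.

(** By symmetry it is enough to integrate over a half-line. *)
Lemma ge0_even_FTC (f F : R -> R) (l : R) : (forall x : R, 0 <= f x) ->
  continuous f -> (forall x : R, f (- x) = f x) ->
  (forall x : R, 0 <= x -> is_derive x 1 F (f x)) ->
  F x @[x --> +oo] --> l ->
  (\int[mu]_x (f x)%:E = (2 * (l - F 0))%:E)%E.
Proof.
move=> f0 cf fN dF Fl.
rewrite ge0_symfun_integralT//; last by move=> x /=; rewrite fN.
rewrite -set_itvcy (@ge0_continuous_FTC2y _ f F 0 l)//.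
- exact: continuous_subspaceT.
- by move=> x x0; have /@ex_derive := dF _ (ltW x0).
- apply: cvg_at_right_filter.
  have /@ex_derive/derivable1_diffP/differentiable_continuous := dF _ (lexx 0).
  exact.
- move=> x; rewrite in_itv/= andbT => x0.
  by rewrite derive1E; have /@derive_val := dF _ (ltW x0).
Qed.

Lemma cvg_expRNM (e : R) : 0 < e -> expR (- (e * x)) @[x --> +oo] --> (0:R).
Proof.
move=> e0.
apply: (@cvg_comp _ _ _ (fun x => e * x) (fun x => expR (- x)) _ (pinfty_nbhs R));
  last exact: cvgr_expR.
exact: gt0_cvgMry.
Qed.

(** The Fourier transform of the weight [abel e]; see [Rintegral_cos_abel]. *)
Definition poisson (e y : R) := 2 * e / (e ^+ 2 + y ^+ 2).

(** The weight that makes the Fourier inversion integral absolutely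
    convergent. *)
Definition abel (e u : R) := expR (- (e * `|u|)).

Lemma poisson_ge0 e y : 0 <= e -> 0 <= poisson e y.
Proof. by move=> e0; rewrite /poisson divr_ge0 ?addr_ge0 ?sqr_ge0 ?mulr_ge0. Qed.

Lemma poissonN e y : poisson e (- y) = poisson e y.
Proof. by rewrite /poisson sqrrN. Qed.

Lemma continuous_poisson e : 0 < e -> continuous (poisson e).
Proof.
move=> e0 y; rewrite /poisson; apply: cvgM; first exact: cvg_cst.
apply: cvgV; first by rewrite gt_eqF// ltr_pwDl ?sqr_ge0 ?exprn_gt0.
by apply: cvgD; [exact: cvg_cst|apply: cvgM].
Qed.

Lemma abel_gt0 e u : 0 < abel e u. Proof. exact: expR_gt0. Qed.

Lemma abel_le1 e u : 0 <= e -> abel e u <= 1.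
Proof. by move=> e0; rewrite /abel -expR0 ler_expR oppr_le0 mulr_ge0. Qed.

Lemma continuous_abel e : continuous (abel e).
Proof.
move=> u; rewrite /abel; apply: continuous_comp; last exact: continuous_expR.
by apply: cvgN; apply: cvgM; [exact: cvg_cst|exact: norm_continuous].
Qed.

Lemma measurable_abel e : measurable_fun [set: measurableTypeR R] (abel e).
Proof. by apply: continuous_measurable; exact: continuous_abel. Qed.

Lemma continuous_cosM (y : R) : continuous (fun u => cos (y * u)).
Proof.
move=> u; apply: continuous_comp; last exact: continuous_cos.
by apply: cvgM => //; exact: cvg_cst.
Qed.

(** The factor is 1 + cos instead of cos because the integrand has to be
    nonnegative for the fundamental theorem on a half-line; the case y = 0
    isolates the contribution of the constant 1. *)
Lemma integral_onedcos_abel (e y : R) : 0 < e ->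
  (\int[mu]_u ((1 + cos (y * u)) * abel e u)%:E = (2 / e + poisson e y)%:E)%E.
Proof.
move=> e0.
have ey0 : e ^+ 2 + y ^+ 2 != 0.
  by rewrite gt_eqF// ltr_pwDl ?sqr_ge0 ?exprn_gt0.
(* - exp (- e u) G u is an antiderivative of (1 + cos (y u)) exp (- e u) *)
pose G u := 1 / e + (e * cos (y * u) - y * sin (y * u)) / (e ^+ 2 + y ^+ 2).
pose F u := - (expR (- (e * u)) * G u).
transitivity (2 * (0 - F 0))%:E; last first.
  rewrite /F /G !mulr0 oppr0 expR0 cos0 sin0 /poisson; congr EFin.
  by field; rewrite ey0/= gt_eqF.
apply: ge0_even_FTC.
- move=> x; apply: mulr_ge0; last exact/ltW/abel_gt0.
  by rewrite -lerBlDl sub0r cos_geN1.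
- move=> x; apply: cvgM; last exact: continuous_abel.
  by apply: cvgD; [exact: cvg_cst|exact: continuous_cosM].
- by move=> x; rewrite mulrN cosN /abel normrN.
- move=> x x0; rewrite /abel ger0_norm// /F /G.
  apply: is_derive_eq; rewrite /GRing.scale/=.
  by field; rewrite ey0/= gt_eqF.
- rewrite /F -oppr0; apply: cvgN.
  apply/norm_cvg0P.
  pose C := `|1 / e| + (`|e| + `|y|) / (e ^+ 2 + y ^+ 2).
  apply: (@squeeze_cvgr _ _ _ _ (cst 0) (fun x => expR (- (e * x)) * C)).
  + near=> x; rewrite normr_ge0/= normrM (ger0_norm (expR_ge0 _)).
    rewrite ler_wpM2l ?expR_ge0// /G /C.
    apply: (le_trans (ler_normD _ _)); rewrite lerD2l normrM.
    rewrite [X in _ * X]ger0_norm; last first.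
      by rewrite invr_ge0 addr_ge0 ?sqr_ge0.
    rewrite ler_wpM2r ?invr_ge0 ?addr_ge0 ?sqr_ge0//.
    apply: (le_trans (ler_normB _ _)); rewrite !normrM.
    by apply: lerD; apply: ler_piMr => //; rewrite ler_norml ?cos_geN1 ?cos_le1 ?sin_geN1 ?sin_le1.
  + exact: cvg_cst.
  + rewrite -[X in _ --> X](mul0r C); apply: cvgM; last exact: cvg_cst.
    exact: cvg_expRNM.
Unshelve. all: end_near. Qed.

Lemma integral_abel (e : R) : 0 < e -> (\int[mu]_u (abel e u)%:E = (2 / e)%:E)%E.
Proof.
move=> e0; have := integral_onedcos_abel 0 e0.
under eq_integral => u _.
  rewrite mul0r cos0 EFinM.
  over.
rewrite ge0_integralZl//; last 2 first.
- apply/measurable_EFinP. exact: measurable_abel.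
- by move=> u _; rewrite lee_fin; exact/ltW/abel_gt0.
move=> /(congr1 (fun x => (2^-1)%:E * x)%E).
rewrite muleA -EFinM mulVf// mul1e => ->.
rewrite -EFinM /poisson; congr EFin; field; by rewrite gt_eqF.
Qed.

Lemma integrable_abel (e : R) : 0 < e -> mu.-integrable setT (EFin \o abel e).
Proof.
move=> e0; apply/integrableP; split.
  by apply/measurable_EFinP; exact: measurable_abel.
under eq_integral => u _ do rewrite /= (ger0_norm (ltW (abel_gt0 _ _))).
by rewrite integral_abel// ltry.
Qed.

Lemma Rintegral_cos_abel (e y : R) : 0 < e ->
  \int[mu]_u (cos (y * u) * abel e u) = poisson e y.
Proof.
move=> e0.
have ic : mu.-integrable setT (EFin \o (fun u => cos (y * u) * abel e u)).
  apply: le_integrable (integrable_abel e0) => //.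
    apply/measurable_EFinP; apply: continuous_measurable => u.
    by apply: cvgM; [exact: continuous_cosM|exact: continuous_abel].
  move=> u _ /=; rewrite lee_fin normrM ler_piMl//.
  by rewrite ler_norml cos_geN1 cos_le1.
have := @integral_onedcos_abel e y e0; move/(congr1 fine) => /=.
rewrite -/(Rintegral _ _ _).
under eq_Rintegral do rewrite mulrDl mul1r.
rewrite RintegralD//; last exact: integrable_abel.
rewrite {1}/Rintegral integral_abel//= => /addrI; exact.
Qed.

(** The kernel is the derivative of a rescaled arctangent, so its mass does
    not depend on e. *)
Lemma integral_poisson (e lam a : R) : 0 < e -> lam != 0 ->
  (\int[mu]_t (poisson e (lam * (a - t)))%:E = (2 * pi / `|lam|)%:E)%E.
Proof.
move=> e0 lam0.
pose f t := poisson e (lam * t).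
have cf : continuous f.
  move=> t; rewrite /f; apply: (@continuous_comp _ _ _ (fun t => lam * t) (poisson e)).
    by apply: cvgM => //; exact: cvg_cst.
  exact: continuous_poisson.
have mf : measurable_fun [set: measurableTypeR R] (fun t => (f t)%:E).
  by apply/measurable_EFinP; apply: continuous_measurable.
have f0 t : (0 <= (f t)%:E)%E by rewrite lee_fin poisson_ge0// ltW.
transitivity (\int[mu]_t (f t)%:E)%E.
  rewrite -(@ge0_integral_translation _ (- a) (fun t => (f t)%:E))//.
  by apply: eq_integral => t _; rewrite /f -[in LHS]poissonN -mulrN opprB.
have l0 : `|lam| != 0 by rewrite normr_eq0.
pose F t := 2 / `|lam| * atan (`|lam| / e * t).
transitivity (2 * (2 / `|lam| * (pi / 2) - F 0))%:E; last first.
  by rewrite /F !mulr0 atan0 mulr0; congr EFin; field.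
apply: ge0_even_FTC.
- by move=> t; rewrite -lee_fin.
- exact: cf.
- by move=> t; rewrite /f mulrN poissonN.
- move=> t t0.
  have E : is_derive t (1:R) (fun t => `|lam| / e * t) (`|lam| / e).
    by apply: is_derive_eq; rewrite /GRing.scale/= mulr1.
  have D := @is_derive1_comp _ (@atan R) (fun t => `|lam| / e * t) t _ _ (is_derive1_atan _) E.
  apply: is_derive_eq; rewrite /f /poisson /GRing.scale/=.
  have nl2 : lam ^+ 2 = `|lam| ^+ 2 by rewrite real_normK ?num_real.
  rewrite [(lam * t) ^+ 2]exprMn nl2.
  have en0 : e != 0 by rewrite gt_eqF.
  field; rewrite en0 l0 andbT gt_eqF//.
  by rewrite ltr_pwDl ?sqr_ge0 ?exprn_gt0.
- apply: cvgM; first exact: cvg_cst.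
  apply: (@cvg_comp _ _ _ (fun x => `|lam| / e * x) (@atan R) _ (pinfty_nbhs R));
    last exact: cvgy_atan.
  by apply: gt0_cvgMry => //; rewrite divr_gt0 ?normr_gt0.
Qed.

End poisson_kernel.

(** * The Fourier transform of a real function *)

Section real_fourier.
Context {R : realType}.
Local Notation mu := (@lebesgue_measure R).
Local Notation T := (measurableTypeR R).
Local Notation itg f := (mu.-integrable setT (EFin \o f)).
Variable lam : R.
Implicit Types p q h : R -> R.

(** The Fourier transform of p is [cosT p] - i [sinT p]; working with its real
    and imaginary parts keeps all integrals real. *)
Definition cosT p (u : R) : R := \int[mu]_t (p t * cos (lam * u * t)).
Definition sinT p (u : R) : R := \int[mu]_t (p t * sin (lam * u * t)).

Lemma measurable_cosF d (X : measurableType d) (f : X -> R) :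
  measurable_fun setT f -> measurable_fun setT (fun x => cos (f x)).
Proof.
by move=> mf; apply: (measurableT_comp (f := @cos R)) => //;
  exact: continuous_measurable (@continuous_cos R).
Qed.

Lemma measurable_sinF d (X : measurableType d) (f : X -> R) :
  measurable_fun setT f -> measurable_fun setT (fun x => sin (f x)).
Proof.
by move=> mf; apply: (measurableT_comp (f := @sin R)) => //;
  exact: continuous_measurable (@continuous_sin R).
Qed.

Lemma measurable_scale (c : R) : measurable_fun [set: T] (fun t : T => c * t).
Proof. exact: (@measurable_funM _ T R setT (cst c) id). Qed.

Lemma integrable_cos p (u : R) : itg p -> itg (fun t => p t * cos (lam * u * t)).
Proof.
move=> ip; apply: (@integrable_mul_bounded _ _ _ _ _ _ 1) => //.
- by apply: measurable_cosF; exact: measurable_scale.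
- by move=> t; exact: cos_max.
Qed.

Lemma integrable_sin p (u : R) : itg p -> itg (fun t => p t * sin (lam * u * t)).
Proof.
move=> ip; apply: (@integrable_mul_bounded _ _ _ _ _ _ 1) => //.
- by apply: measurable_sinF; exact: measurable_scale.
- by move=> t; exact: sin_max.
Qed.

Definition norm1 p := \int[mu]_t `|p t|.

Lemma norm1_ge0 p : 0 <= norm1 p.
Proof. by apply: Rintegral_ge0. Qed.

Lemma integrable_normr p : itg p -> itg (fun t => `|p t|).
Proof. by move=> /integrable_abse. Qed.

Lemma norm_cosT p u : itg p -> `|cosT p u| <= norm1 p.
Proof.
move=> ip; apply: (le_trans (le_normr_Rintegral measurableT (integrable_cos u ip))).
apply: le_Rintegral => //.
- exact/integrable_normr/integrable_cos.
- exact: integrable_normr.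
- by move=> t _; rewrite normrM ler_piMr// cos_max.
Qed.

Lemma norm_sinT p u : itg p -> `|sinT p u| <= norm1 p.
Proof.
move=> ip; apply: (le_trans (le_normr_Rintegral measurableT (integrable_sin u ip))).
apply: le_Rintegral => //.
- exact/integrable_normr/integrable_sin.
- exact: integrable_normr.
- by move=> t _; rewrite normrM ler_piMr// sin_max.
Qed.

Lemma measurable_phase : measurable_fun [set: T * T] (fun z : T * T => lam * z.1 * z.2).
Proof.
apply: (@measurable_funM _ _ R setT (fun z : T * T => lam * z.1) snd) => //.
by apply: (@measurable_funM _ _ R setT (cst lam) fst).
Qed.

Lemma measurable_cosT p : measurable_fun [set: T] p -> measurable_fun [set: T] (cosT p).
Proof.
move=> mp; apply: (@measurable_fun_Rintegral _ _ T T R mu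
  (fun z : T * T => p z.2 * cos (lam * z.1 * z.2))).
apply: (@measurable_funM _ _ R setT (p \o snd)); first exact: measurableT_comp.
by apply: measurable_cosF; exact: measurable_phase.
Qed.

Lemma measurable_sinT p : measurable_fun [set: T] p -> measurable_fun [set: T] (sinT p).
Proof.
move=> mp; apply: (@measurable_fun_Rintegral _ _ T T R mu
  (fun z : T * T => p z.2 * sin (lam * z.1 * z.2))).
apply: (@measurable_funM _ _ R setT (p \o snd)); first exact: measurableT_comp.
by apply: measurable_sinF; exact: measurable_phase.
Qed.

(** The Poisson mean of h, multiplied by the mass of the kernel. *)
Definition smooth_by (e : R) h (t : R) : R :=
  \int[mu]_s (h s * poisson e (lam * (t - s))).

(** The left-hand side is the real part of exp (i lam u t) times the Fourier
    transform of h. *)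
Lemma cosT_sinT_phase h u t : itg h ->
  cosT h u * cos (lam * u * t) + sinT h u * sin (lam * u * t) =
  \int[mu]_s (h s * cos (lam * (t - s) * u)).
Proof.
move=> ih; rewrite /cosT /sinT -!RintegralZr//; last 2 first.
- exact: integrable_sin.
- exact: integrable_cos.
rewrite -RintegralD//; last 2 first.
- apply: (@integrable_mul_bounded _ _ _ _ _ _ 1) => //; last exact: integrable_cos.
  by move=> _; exact: cos_max.
- apply: (@integrable_mul_bounded _ _ _ _ _ _ 1) => //; last exact: integrable_sin.
  by move=> _; exact: sin_max.
apply: eq_Rintegral => s _.
have -> : lam * (t - s) * u = lam * u * t - lam * u * s by ring.
by rewrite cosB; ring.
Qed.

(** Inversion with the Abel weight returns a Poisson mean of h. *)
Lemma abel_smoothing (e : R) h t : 0 < e -> itg h ->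
  \int[mu]_u (abel e u *
    (cosT h u * cos (lam * u * t) + sinT h u * sin (lam * u * t))) =
  smooth_by e h t.
Proof.
move=> e0 ih.
transitivity (\int[mu]_u (\int[mu]_s
   (abel e u * h s * cos (lam * (t - s) * u)))).
  apply: eq_Rintegral => u _; rewrite cosT_sinT_phase// -RintegralZl//.
    by apply: eq_Rintegral => s _; rewrite mulrA.
  apply: (@integrable_mul_bounded _ _ _ _ _ _ 1) => //.
  - apply: measurable_cosF; apply: measurable_funM => //.
    by apply: measurable_funM => //; exact: measurable_funB.
  - by move=> s; exact: cos_max.
rewrite (@Rintegral_swap _ _ T T R mu mu
  (fun z : T * T => abel e z.1 * h z.2 * cos (lam * (t - z.2) * z.1))).
  apply: eq_Rintegral => s _.
  rewrite -(Rintegral_cos_abel _ e0) -RintegralZl//.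
    by apply: eq_Rintegral => u _; ring.
  under eq_fun do rewrite mulrC.
  apply: (@integrable_mul_bounded _ _ _ _ _ _ 1) => //.
  - by apply: measurable_cosF; exact: measurable_scale.
  - by move=> u; exact: cos_max.
  - exact: integrable_abel.
apply: (@integrable_mul_bounded _ _ _ _ _ _ 1) => //.
- apply: measurable_cosF; apply: measurable_funM => //.
  by apply: measurable_funM => //; exact: measurable_funB.
- by move=> u; exact: cos_max.
- by apply: integrable_tensor => //; exact: integrable_abel.
Qed.

Lemma integrable_abel_mul (e M : R) (g : R -> R) : 0 < e ->
  measurable_fun [set: T] g -> (forall u, `|g u| <= M) ->
  itg (fun u => abel e u * g u).
Proof.
by move=> e0 mg gM; apply: (@integrable_mul_bounded _ _ _ _ _ _ M) => //;
  exact: integrable_abel.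
Qed.

(** The real part of the Hermitian pairing of the two transforms, with the Abel
    weight that makes it finite for all integrable p and h. *)
Definition energy e p h : R :=
  \int[mu]_u (abel e u * (cosT p u * cosT h u + sinT p u * sinT h u)).

(** Fubini, once in the variable of p and once, through [abel_smoothing], in
    that of h. *)
Lemma energyE (e : R) p h : 0 < e -> itg p -> itg h ->
  energy e p h = \int[mu]_t (p t * smooth_by e h t).
Proof.
move=> e0 ip ih.
pose K u t := cosT h u * cos (lam * u * t) + sinT h u * sin (lam * u * t).
have KM u t : `|K u t| <= norm1 h + norm1 h.
  rewrite /K (le_trans (ler_normD _ _))// lerD// normrM.
    by rewrite (le_trans _ (norm_cosT u ih))// ler_piMr// cos_max.
  by rewrite (le_trans _ (norm_sinT u ih))// ler_piMr// sin_max.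
have mK : measurable_fun [set: T * T] (fun z : T * T => K z.1 z.2).
  have mh := integrable_EFin_measurable ih.
  apply: measurable_funD; apply: measurable_funM.
  - by apply: (measurableT_comp (f := cosT h)) => //; exact: measurable_cosT.
  - by apply: measurable_cosF; exact: measurable_phase.
  - by apply: (measurableT_comp (f := sinT h)) => //; exact: measurable_sinT.
  - by apply: measurable_sinF; exact: measurable_phase.
transitivity (\int[mu]_u (\int[mu]_t (abel e u * p t * K u t))).
  apply: eq_Rintegral => u _.
  rewrite (_ : cosT p u * cosT h u + sinT p u * sinT h u =
    \int[mu]_t (p t * K u t)).
    rewrite -RintegralZl//.
      by apply: eq_Rintegral => t _; rewrite mulrA.
    apply: (@integrable_mul_bounded _ _ _ _ _ _ (norm1 h + norm1 h)) => //.
    exact: (measurableT_comp mK (measurable_pair1 u)).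
  rewrite {1}/cosT {1}/sinT -!RintegralZr//; last 2 first.
  - exact: integrable_sin.
  - exact: integrable_cos.
  rewrite -RintegralD//; last 2 first.
  - apply: (@integrable_mul_bounded _ _ _ _ _ _ `|cosT h u|) => //.
    exact: integrable_cos.
  - apply: (@integrable_mul_bounded _ _ _ _ _ _ `|sinT h u|) => //.
    exact: integrable_sin.
  by apply: eq_Rintegral => t _; rewrite /K; ring.
rewrite (@Rintegral_swap _ _ T T R mu mu
  (fun z : T * T => abel e z.1 * p z.2 * K z.1 z.2)).
  apply: eq_Rintegral => t _.
  rewrite -abel_smoothing// -RintegralZl//.
    by apply: eq_Rintegral => u _; rewrite /K; ring.
  apply: (@integrable_abel_mul _ (norm1 h + norm1 h)) => //.
    exact: (measurableT_comp mK (measurable_pair2 t)).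
  by move=> u; exact: KM.
apply: (@integrable_mul_bounded _ _ _ _ (fun z : T * T => abel e z.1 * p z.2)
  (fun z : T * T => K z.1 z.2) (norm1 h + norm1 h)) => //.
by apply: integrable_tensor => //; exact: integrable_abel.
Qed.

End real_fourier.

(** * Continuity of translations and Poisson means *)

Section translation_continuity.
Context {R : realType}.
Local Notation mu := (@lebesgue_measure R).
Local Notation T := (measurableTypeR R).
Local Notation itg f := (mu.-integrable setT (EFin \o f)).

(** Compactness of the segment, in the form of near coverings, makes the
    modulus of continuity uniform. *)
Lemma uniform_continuity_segment (r : R -> R) (N eta : R) :
  continuous r -> 0 < eta ->
  exists2 d, 0 < d & forall y, `|y| < d ->
    forall t, `[-N, N]%classic t -> `|r (t + y) - r t| <= eta.
Proof.
move=> cr eta0.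
have /compact_near_coveringP := @segment_compact R (-N) N.
move=> /(_ R (nbhs 0) (fun y t => `|r (t + y) - r t| <= eta) _) [].
  move=> t _.
  have c1 : (fun z : R * R => r (z.1 + z.2) - r z.1) x @[x --> (t, 0)] --> r (t + 0) - r t.
    apply: cvgB.
      apply: (@cvg_comp _ _ _ (fun z : R * R => z.1 + z.2) r _ (nbhs (t + 0))).
        exact: (@add_continuous R^o (t, 0)).
      exact: cr.
    apply: (@cvg_comp _ _ _ fst r _ (nbhs t)); first exact: cvg_fst.
    exact: cr.
  rewrite addr0 subrr in c1.
  by have /cvgr0Pnorm_le := c1; apply.
move=> d /= d0 H; exists d => // y yd; apply: H => /=.
by rewrite sub0r normrN.
Qed.

Lemma segment_measure (N : R) : 0 < N -> mu `[- N, N]%classic = (2 * N)%:E.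
Proof.
move=> N0; rewrite lebesgue_measure_itv/= lte_fin ifT; last by lra.
by rewrite -EFinB; congr EFin; ring.
Qed.

(** Approximate p in L1, on a slightly larger window, by a continuous
    function: it is uniformly continuous on the window, and the error is not
    changed by the translation. *)
Lemma translation_continuity (p : R -> R) (N eta : R) : itg p -> 0 < N -> 0 < eta ->
  exists2 d, 0 < d & forall y, `|y| < d ->
   (\int[mu]_t (\1_(`[-N, N]%classic) t * `|p (t + y) - p t|)%:E <= eta%:E)%E.
Proof.
move=> ip N0 eta0.
have mp : measurable_fun [set: T] p by case/integrableP : ip => /measurable_EFinP.
pose E := `[-N, N]%classic : set R.
pose E' := `[-(N + 1), N + 1]%classic : set R.
have mE : measurable (E : set T) by exact: measurable_itv.
have mE' : measurable (E' : set T) by exact: measurable_itv.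
have muE' : mu E' = (2 * (N + 1))%:E := segment_measure (addr_gt0 N0 ltr01).
have muE : mu E = (2 * N)%:E := segment_measure N0.
have [g [cg _ gcvg]] : exists g_ : (R -> R)^nat,
    [/\ forall n, continuous (g_ n),
        forall n, mu.-integrable E' (EFin \o g_ n) &
        (\int[mu]_(z in E') `|(p z - g_ n z)%:E| @[n --> \oo] --> 0)%E].
  apply: approximation_continuous_integrable.
  - exact: mE'.
  - by have : (mu E' < +oo)%E by rewrite muE' ltry.
  - exact: (integrableS measurableT mE' _ ip).
have [r cr rE'] : exists2 r : R -> R, continuous r &
    (\int[mu]_(z in E') `|(p z - r z)%:E| < (eta / 3)%:E)%E.
  have eta3 : 0 < eta / 3 by rewrite divr_gt0.
  have : \forall n \near \oo, (\int[mu]_(z in E') `|(p z - g n z)%:E| < (eta / 3)%:E)%E.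
    exact: cvge0_lt gcvg eta3.
  by move=> [n _ /(_ n (leqnn n)) nb]; exists (g n).
have mr : measurable_fun [set: T] r by exact: continuous_measurable.
pose q t := \1_E' t * `|p t - r t|.
have mq : measurable_fun [set: T] q.
  apply: (@measurable_funM _ T R setT (\1_E')).
    exact: measurable_indic.
  by apply: measurableT_comp => //; exact: measurable_funB.
have q0 t : 0 <= q t by rewrite mulr_ge0.
have Iq : (\int[mu]_t (q t)%:E <= (eta / 3)%:E)%E.
  apply/ltW; move: rE'; rewrite integral_mkcond; congr (_ < _)%E.
  apply: eq_integral => t _; rewrite patchE /q indicE.
  by case: (t \in E'); rewrite ?mul1r ?mul0r.
(* one third of eta, spread over a window of length 2 N *)
pose e1 := eta / 3 / (2 * N).
have e10 : 0 < e1 by rewrite !divr_gt0// mulr_gt0.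
have [d1 d10 Hd1] := uniform_continuity_segment N cr e10.
(* with |y| < 1 the translated window stays inside E' *)
exists (Num.min d1 1); first by rewrite lt_min d10 ltr01.
move=> y; rewrite lt_min => /andP[yd1 y1].
have mshift : measurable_fun [set: T] (fun t : T => t + y : T).
  exact: measurable_translation.
pose b t := \1_E t * e1.
have mb : measurable_fun [set: T] b.
  by apply: measurable_funM => //; exact: measurable_indic.
have b0 t : 0 <= b t by rewrite mulr_ge0// ltW.
apply: (@le_trans _ _ (\int[mu]_t (q (t + y) + (b t + q t))%:E)%E).
  apply: le_integral_EFin.
  - apply: measurable_funM; first exact: measurable_indic.
    apply: measurableT_comp => //; apply: measurable_funB => //.
    exact: (measurableT_comp mp mshift).
  - apply: measurable_funD; first exact: (measurableT_comp mq mshift).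
    exact: measurable_funD.
  - by move=> t; rewrite mulr_ge0.
  - move=> t; rewrite /q /b indicE.
    have [tE|tE] := boolP (t \in E); last first.
      by rewrite !mul0r add0r addr_ge0// mulr_ge0.
    have tN : `[-N, N]%classic t by rewrite inE in tE.
    have tE' : t \in E'.
      by move: tN; rewrite inE /E' /= !in_itv/= => /andP[? ?]; apply/andP; split; lra.
    have tyE' : t + y \in E'.
      move: y1 tN; rewrite inE /E' /= !in_itv/= ltr_norml => /andP[? ?] /andP[? ?].
      by apply/andP; split; lra.
    rewrite !indicE tE' tyE' !mul1r.
    have := Hd1 y yd1 t tN => H.
    rewrite (_ : p (t + y) - p t = (p (t + y) - r (t + y)) + ((r (t + y) - r t) - (p t - r t))); last by ring.
    by rewrite (le_trans (ler_normD _ _))// lerD2l (le_trans (ler_normB _ _))// lerD2r.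
rewrite integral_EFinD//; last 3 first.
- exact: (measurableT_comp mq mshift).
- exact: measurable_funD.
- by move=> t; rewrite addr_ge0.
rewrite integral_EFinD//.
rewrite (@ge0_integral_translation _ y (fun t => (q t)%:E))//; last first.
  by apply/measurable_EFinP.
have -> : (\int[mu]_t (b t)%:E = (eta / 3)%:E)%E.
  rewrite /b; under eq_integral do rewrite mulrC.
  rewrite integral_EFinZ//; last exact: ltW.
  transitivity (e1%:E * (2 * N)%:E)%E.
    by congr (_ * _)%E; rewrite integral_indic// setIT; exact: muE.
  rewrite -EFinM /e1; congr EFin; field; by rewrite gt_eqF.
apply: (@le_trans _ _ (eta / 3 + (eta / 3 + eta / 3))%:E).
  by rewrite !EFinD; apply: leeD => //; apply: leeD.
by rewrite lee_fin; lra.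
Qed.


End translation_continuity.

Section smoothing.
Context {R : realType}.
Local Notation mu := (@lebesgue_measure R).
Local Notation T := (measurableTypeR R).
Local Notation itg f := (mu.-integrable setT (EFin \o f)).
Variable lam : R.
Hypothesis lam0 : lam != 0.
Implicit Types p h : R -> R.

Let K : R := 2 * pi / `|lam|.

Let K0 : 0 < K.
Proof. by rewrite /K !mulr_gt0 ?pi_gt0// invr_gt0 normr_gt0. Qed.

Lemma integral_poisson0 (e : R) : 0 < e ->
  (\int[mu]_t (poisson e (lam * t))%:E = K%:E)%E.
Proof.
move=> e0; rewrite -(integral_poisson 0 e0 lam0).
by apply: eq_integral => t _; rewrite sub0r mulrN poissonN.
Qed.

Lemma measurable_poisson (e : R) : 0 < e -> measurable_fun [set: T] (poisson e).
Proof. by move=> e0; apply: continuous_measurable; exact: continuous_poisson. Qed.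

Lemma measurable_poisson_scale (e : R) : 0 < e ->
  measurable_fun [set: T] (fun t : T => poisson e (lam * t)).
Proof.
by move=> e0; apply: (measurableT_comp (measurable_poisson e0)); exact: measurable_scale.
Qed.

Lemma measurable_poisson2 (e : R) : 0 < e ->
  measurable_fun [set: T * T] (fun z : T * T => poisson e (lam * (z.1 - z.2))).
Proof.
move=> e0; apply: (measurableT_comp (measurable_poisson e0)).
by apply: (@measurable_funM _ _ R setT (cst lam)) => //; exact: measurable_funB.
Qed.

(** Away from the origin the kernel is O(e) times a fixed integrable kernel. *)
Lemma poisson_tail (e m y : R) : 0 < e -> 0 < m -> m <= y ^+ 2 ->
  poisson e y <= e * (1 + 1 / m) * poisson 1 y.
Proof.
move=> e0 m0 my; rewrite /poisson.
have y2 : 0 < y ^+ 2 by rewrite (lt_le_trans m0).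
apply: (@le_trans _ _ (2 * e / y ^+ 2)).
  rewrite ler_wpM2l ?mulr_ge0 ?(ltW e0)// lef_pV2 ?posrE//.
    by rewrite lerDr sqr_ge0.
  by rewrite ltr_wpDl ?sqr_ge0.
rewrite expr1n mulr1.
rewrite [X in _ <= X](_ : _ = 2 * e * ((1 + 1 / m) / (1 + y ^+ 2))); last by ring.
rewrite ler_wpM2l ?mulr_ge0 ?(ltW e0)// ler_pdivlMr ?addr_gt0//.
rewrite mulrDr mulr1 mulVf ?gt_eqF// addrC lerD2l.
by rewrite mul1r lef_pV2 ?posrE.
Qed.

(** With s = t + y, the double integral becomes the integral in y of the
    kernel times the L1 modulus of continuity of p at y.  That modulus is small
    near 0 by [translation_continuity], and bounded elsewhere, where the kernel
    is small by [poisson_tail]. *)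
Lemma smoothing_defect p (N eta : R) : itg p -> 0 < N -> 0 < eta ->
  exists2 e, 0 < e & (\int[mu]_t \int[mu]_s
    (\1_(`[-N, N]%classic) t * `|p t - p s| * poisson e (lam * (t - s)))%:E
      <= eta%:E)%E.
Proof.
move=> ip N0 eta0.
have mp := integrable_EFin_measurable ip.
pose E : set R := `[-N, N]%classic.
have mE : measurable (E : set T) by exact: measurable_itv.
have m1 : measurable_fun [set: T] (\1_E : T -> R) by exact: measurable_indic.
(* after integration against the kernel, this contributes eta / 2 *)
pose eta1 := eta / (2 * K).
have eta10 : 0 < eta1 by rewrite divr_gt0// mulr_gt0.
have [d d0 Hd] := translation_continuity ip N0 eta10.
(* bound of the L1 modulus of continuity at every y *)
pose B := 2 * norm1 p.
have B0 : 0 <= B by rewrite mulr_ge0// norm1_ge0.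
pose m := (lam * d) ^+ 2.
have m0 : 0 < m by rewrite exprn_even_gt0//= mulf_neq0// gt_eqF.
(* the tail contributes at most e c, which the choice of e makes eta / 2 *)
pose c := (1 + 1 / m) * (B + 1) * K.
have m10 : 0 < 1 + 1 / m by rewrite addr_gt0// divr_gt0.
have B10 : 0 < B + 1 by rewrite ltr_wpDl.
have c0 : 0 < c by rewrite /c mulr_gt0// mulr_gt0.
pose e := eta / 2 / c.
have e0 : 0 < e by rewrite !divr_gt0.
exists e => //.
pose F (z : T * T) : R := \1_E z.2 * `|p (z.2 + z.1) - p z.2| * poisson e (lam * z.1).
have madd : measurable_fun [set: T * T] (fun z : T * T => z.2 + z.1 : T).
  exact: (@measurable_funD _ _ R setT snd fst).
have mF : measurable_fun [set: T * T] F.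
  apply: measurable_funM; last first.
    exact: (measurableT_comp (measurable_poisson_scale e0) measurable_fst).
  apply: measurable_funM; first exact: (measurableT_comp m1 measurable_snd).
  apply: measurableT_comp => //; apply: measurable_funB.
    exact: (measurableT_comp mp madd).
  exact: (measurableT_comp mp measurable_snd).
have F0 z : 0 <= F z.
  by apply: mulr_ge0; [exact: mulr_ge0|exact/poisson_ge0/ltW].
have mEF : measurable_fun [set: T * T] (EFin \o F) by exact/measurable_EFinP.
have -> : (\int[mu]_t \int[mu]_s
    (\1_E t * `|p t - p s| * poisson e (lam * (t - s)))%:E =
    \int[mu]_t \int[mu]_y (F (y, t))%:E)%E.
  apply: eq_integral => t _.
  rewrite -(@ge0_integral_translation _ t (fun s =>
    (\1_E t * `|p t - p s| * poisson e (lam * (t - s)))%:E)); last 2 first.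
  - apply/measurable_EFinP; apply: measurable_funM.
      apply: measurable_funM => //; apply: measurableT_comp => //.
      exact: measurable_funB.
    exact: (measurableT_comp (measurable_poisson2 e0) (measurable_pair1 t)).
  - by move=> s; rewrite lee_fin; apply: mulr_ge0;
      [exact: mulr_ge0|exact/poisson_ge0/ltW].
  apply: eq_integral => y _; rewrite /F /= distrC [y + t]addrC.
  by rewrite opprD addNKr mulrN poissonN.
rewrite -(@fubini_tonelli _ _ T T R mu mu (EFin \o F))//.
pose w y := (\int[mu]_t (\1_E t * `|p (t + y) - p t|)%:E)%E.
have mw y : measurable_fun [set: T] (fun t : T => \1_E t * `|p (t + y) - p t|).
  apply: measurable_funM => //; apply: measurableT_comp => //.
  by apply: measurable_funB => //; exact: (measurableT_comp mp (measurable_translation y)).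
have FE y : (\int[mu]_t (F (y, t))%:E = (poisson e (lam * y))%:E * w y)%E.
  rewrite /F /=; under eq_integral do rewrite mulrC.
  rewrite integral_EFinZ//; first by rewrite poisson_ge0// ltW.
have wB y : (w y <= B%:E)%E.
  apply: (@le_trans _ _ (\int[mu]_t (`|p (t + y)| + `|p t|)%:E)%E).
    apply: le_integral_EFin => //.
    - apply: measurable_funD; last exact: measurableT_comp.
      apply: measurableT_comp => //.
      exact: (measurableT_comp mp (measurable_translation y)).
    - move=> t; apply: le_trans (ler_normB _ _).
      by rewrite ler_piMl// indicE; case: (_ \in _).
  rewrite integral_EFinD//; last 2 first.
  - apply: measurableT_comp => //.
    exact: (measurableT_comp mp (measurable_translation y)).
  - exact: measurableT_comp.
  rewrite (@ge0_integral_translation _ y (fun t => `|p t|%:E))//; last first.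
    by apply/measurable_EFinP; exact: measurableT_comp.
  rewrite EFin_Rintegral ?integrable_normr// -EFinD lee_fin /B /norm1.
  by rewrite mulr2n mulrDl mul1r.
apply: (@le_trans _ _ (\int[mu]_y (eta1 * poisson e (lam * y) +
    (e * (1 + 1 / m) * B) * poisson 1 (lam * y))%:E)%E).
  apply: ge0_le_integral => //.
  - by move=> y _; apply: integral_ge0 => t _; rewrite lee_fin.
  - exact: (measurable_fun_fubini_tonelli_F (EFin \o F)).
  - by apply/measurable_EFinP; apply: measurable_funD;
      apply: measurable_funM => //; exact: measurable_poisson_scale.
  - move=> y _; rewrite /= FE.
    have P0 := @poisson_ge0 R e (lam * y) (ltW e0).
    have Q0 := @poisson_ge0 R 1 (lam * y) ler01.
    have D0 : 0 <= e * (1 + 1 / m).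
      by rewrite mulr_ge0 ?(ltW e0)// ltW.
    have [yd|dy] := ltP `|y| d.
      apply: (@le_trans _ _ ((poisson e (lam * y))%:E * eta1%:E)%E).
        by rewrite lee_wpmul2l ?lee_fin//; exact: Hd.
      rewrite -EFinM lee_fin mulrC lerDl.
      by apply: mulr_ge0 => //; apply: mulr_ge0.
    apply: (@le_trans _ _ ((poisson e (lam * y))%:E * B%:E)%E).
      by rewrite lee_wpmul2l ?lee_fin.
    rewrite -EFinM lee_fin (@le_trans _ _ (e * (1 + 1 / m) * poisson 1 (lam * y) * B))//.
      rewrite ler_wpM2r// poisson_tail// /m !exprMn ler_wpM2l ?sqr_ge0//.
      by rewrite -(real_normK (num_real y)) lerXn2r// nnegrE ltW.
    by rewrite [leRHS]addrC mulrAC lerDl; apply: mulr_ge0 => //; exact: ltW.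
have mP := measurable_poisson_scale e0.
have mP1 := measurable_poisson_scale (@ltr01 R).
have D0 : 0 <= e * (1 + 1 / m) * B by apply: mulr_ge0 => //; apply: mulr_ge0; exact: ltW.
have P0 y := @poisson_ge0 R e (lam * y) (ltW e0).
have Q0 y := @poisson_ge0 R 1 (lam * y) ler01.
rewrite integral_EFinD; first last.
- by move=> y; apply: mulr_ge0.
- by move=> y; apply: mulr_ge0 => //; exact: ltW.
- exact: measurable_funM.
- exact: measurable_funM.
rewrite [X in (X + _)%E]integral_EFinZ//; last exact: ltW.
rewrite [X in (_ + X)%E]integral_EFinZ//.
rewrite [X in (_ * X + _)%E](integral_poisson0 e0).
rewrite [X in (_ + _ * X)%E](integral_poisson0 ltr01).
rewrite -!EFinM -EFinD lee_fin.
have -> : eta1 * K = eta / 2 by rewrite /eta1; field; rewrite gt_eqF.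
have -> : e * (1 + 1 / m) * B * K = eta / 2 * (B / (B + 1)).
  rewrite /e /c; field.
  by rewrite !gt_eqF// addr_gt0.
have : B / (B + 1) <= 1 by rewrite ler_pdivrMr ?mul1r ?lerDl// ltr_wpDl.
have : 0 < eta / 2 by rewrite divr_gt0.
nra.
Qed.

End smoothing.

(** * Plancherel's inequality on the line *)

Section real_plancherel.
Context {R : realType}.
Local Notation mu := (@lebesgue_measure R).
Local Notation T := (measurableTypeR R).
Local Notation itg f := (mu.-integrable setT (EFin \o f)).
Variable lam : R.
Hypothesis lam0 : lam != 0.
Implicit Types p h : R -> R.
Local Notation K := (2 * pi / `|lam|).
Local Notation cosT := (cosT lam).
Local Notation sinT := (sinT lam).
Local Notation energy := (energy lam).
Local Notation smooth_by := (smooth_by lam).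

Lemma energyC (e : R) p h : energy e p h = energy e h p.
Proof.
rewrite /energy; apply: eq_Rintegral => u _; congr (_ * _).
by congr (_ + _); rewrite mulrC.
Qed.

Lemma integrable_energy_density (e : R) p h : 0 < e -> itg p -> itg h ->
  itg (fun u => abel e u * (cosT p u * cosT h u + sinT p u * sinT h u)).
Proof.
move=> e0 ip ih; have [mp mh] := (integrable_EFin_measurable ip, integrable_EFin_measurable ih).
apply: (@integrable_abel_mul _ _ (norm1 p * norm1 h + norm1 p * norm1 h)) => //.
  apply: measurable_funD; apply: measurable_funM.
  - exact: measurable_cosT.
  - exact: measurable_cosT.
  - exact: measurable_sinT.
  - exact: measurable_sinT.
move=> u; apply: (le_trans (ler_normD _ _)); rewrite !normrM.
apply: lerD; apply: ler_pM => //.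
- exact: norm_cosT.
- exact: norm_cosT.
- exact: norm_sinT.
- exact: norm_sinT.
Qed.

(** The energy of p - h is nonnegative. *)
Lemma energy_polarization (e : R) p h : 0 < e -> itg p -> itg h ->
  2 * energy e p h <= energy e p p + energy e h h.
Proof.
move=> e0 ip ih; rewrite /energy -RintegralZl//; last exact: integrable_energy_density.
have ipp := integrable_energy_density e0 ip ip.
have ihh := integrable_energy_density e0 ih ih.
rewrite -(RintegralD measurableT ipp ihh).
apply: le_Rintegral => //.
- by apply: integrable_EFinZ; exact: integrable_energy_density.
- exact: integrable_EFinD ipp ihh.
move=> u _; rewrite -mulrDr mulrCA ler_wpM2l ?(ltW (abel_gt0 _ _))//.
rewrite -subr_ge0.
rewrite (_ : _ - _ = (cosT p u - cosT h u) ^+ 2 + (sinT p u - sinT h u) ^+ 2).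
  by rewrite addr_ge0 ?sqr_ge0.
by ring.
Qed.

(** The Abel weight is at most 1. *)
Lemma energy_le (e : R) p : 0 < e -> itg p ->
  ((energy e p p)%:E <= \int[mu]_u (cosT p u ^+ 2 + sinT p u ^+ 2)%:E)%E.
Proof.
move=> e0 ip; have mp := integrable_EFin_measurable ip.
have mc := measurable_cosT lam mp; have ms := measurable_sinT lam mp.
rewrite /energy -EFin_Rintegral; last exact: integrable_energy_density.
apply: le_integral_EFin.
- apply: measurable_funM; first exact: measurable_abel.
  by apply: measurable_funD; apply: measurable_funM.
- by apply: measurable_funD; apply: measurable_funX.
- by move=> u; rewrite mulr_ge0 ?(ltW (abel_gt0 _ _))// -!expr2 addr_ge0 ?sqr_ge0.
- move=> u; rewrite -!expr2; apply: ler_piMl; last exact/abel_le1/ltW.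
  by rewrite addr_ge0 ?sqr_ge0.
Qed.

Lemma poisson_le (e y : R) : 0 < e -> poisson e y <= 2 / e.
Proof.
move=> e0; rewrite /poisson ler_pdivrMr ?ltr_pwDl ?sqr_ge0 ?exprn_gt0//.
rewrite mulrDr -[leLHS]addr0 lerD//; last first.
  by rewrite mulr_ge0 ?sqr_ge0// divr_ge0// ltW.
by rewrite expr2 mulrA divfK// gt_eqF.
Qed.

Lemma measurable_poisson_sub (e t : R) : 0 < e ->
  measurable_fun [set: T] (fun s : T => poisson e (lam * (t - s))).
Proof.
by move=> e0; exact: (measurableT_comp (measurable_poisson2 lam e0) (measurable_pair1 t)).
Qed.

Lemma norm_poisson_le (e y : R) : 0 < e -> `|poisson e y| <= 2 / e.
Proof. by move=> e0; rewrite ger0_norm ?poisson_le// poisson_ge0// ltW. Qed.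

Lemma integrable_poisson_conv (e t : R) h : 0 < e -> itg h ->
  itg (fun s => h s * poisson e (lam * (t - s))).
Proof.
move=> e0 ih; apply: (@integrable_mul_bounded _ _ _ _ _ _ (2 / e)) => //.
- exact: measurable_poisson_sub.
- by move=> s; exact: norm_poisson_le.
Qed.

Lemma integrable_poisson_sub (e t : R) : 0 < e ->
  itg (fun s => poisson e (lam * (t - s))).
Proof.
move=> e0; apply: integrable_lt.
- exact: measurable_poisson_sub.
- by move=> s; exact/poisson_ge0/ltW.
- by rewrite integral_poisson// ltry.
Qed.

Lemma measurable_smooth_by (e : R) h : 0 < e -> itg h ->
  measurable_fun [set: T] (smooth_by e h).
Proof.
move=> e0 ih; have mh := integrable_EFin_measurable ih.
apply: (@measurable_fun_Rintegral _ _ T T R mu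
  (fun z : T * T => h z.2 * poisson e (lam * (z.1 - z.2)))).
apply: measurable_funM; first exact: (measurableT_comp mh measurable_snd).
exact: measurable_poisson2.
Qed.

Lemma norm_smooth_by (e t : R) h : 0 < e -> itg h ->
  `|smooth_by e h t| <= norm1 h * (2 / e).
Proof.
move=> e0 ih.
have ci := @integrable_poisson_conv e t h e0 ih.
apply: (le_trans (le_normr_Rintegral measurableT ci)).
rewrite /norm1 -RintegralZr//; last exact: integrable_normr.
apply: le_Rintegral => //.
- exact: integrable_normr.
- apply: (@integrable_mul_bounded _ _ _ _ _ _ `|2 / e|) => //.
  exact: integrable_normr.
- by move=> s _; rewrite normrM ler_wpM2l// norm_poisson_le.
Qed.

Lemma integral_poisson_left (e : R) (g : R -> R) : 0 < e ->
  measurable_fun [set: T] g -> (forall x, 0 <= g x) ->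
  (\int[mu]_t \int[mu]_s (g t * poisson e (lam * (t - s)))%:E =
   K%:E * \int[mu]_t (g t)%:E)%E.
Proof.
move=> e0 mg g0; rewrite -integral_EFinZ//; last first.
  by rewrite divr_ge0// mulr_ge0// pi_ge0.
apply: eq_integral => t _; rewrite integral_EFinZ//.
- by rewrite [X in (_ * X)%E](integral_poisson _ e0 lam0) -EFinM mulrC.
- exact: measurable_poisson_sub.
- by move=> s; exact/poisson_ge0/ltW.
Qed.

Lemma integral_poisson_right (e : R) (g : R -> R) : 0 < e ->
  measurable_fun [set: T] g -> (forall x, 0 <= g x) ->
  (\int[mu]_t \int[mu]_s (g s * poisson e (lam * (t - s)))%:E =
   K%:E * \int[mu]_t (g t)%:E)%E.
Proof.
move=> e0 mg g0.
rewrite (@fubini_tonelli _ _ T T R mu mu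
  (fun z : T * T => (g z.2 * poisson e (lam * (z.1 - z.2)))%:E)).
- rewrite -(integral_poisson_left e0 mg g0).
  apply: eq_integral => s _; apply: eq_integral => t _ /=.
  by rewrite -poissonN -mulrN opprB.
- apply/measurable_EFinP; apply: measurable_funM.
    exact: (measurableT_comp mg measurable_snd).
  exact: measurable_poisson2.
- by move=> z; rewrite lee_fin; apply: mulr_ge0 => //; exact/poisson_ge0/ltW.
Qed.

Lemma integrable_sqr h (M : R) : itg h -> (forall t, `|h t| <= M) ->
  itg (fun t => h t ^+ 2).
Proof.
by move=> ih hM; exact: (integrable_mul_bounded (integrable_EFin_measurable ih) hM ih).
Qed.

(** Schur's test: the kernel is symmetric with mass K, and |h t| |h s| is at
    most half the sum of the squares. *)
Lemma energy_le_L2 (e M : R) h : 0 < e -> itg h -> (forall t, `|h t| <= M) ->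
  energy e h h <= K * \int[mu]_t (h t ^+ 2).
Proof.
move=> e0 ih hM; rewrite energyE//.
have mh := integrable_EFin_measurable ih.
have hsi := integrable_sqr ih hM.
have Wi : itg (fun t => h t * smooth_by e h t).
  apply: (@integrable_mul_bounded _ _ _ _ _ _ (norm1 h * (2 / e))) => //.
  - exact: measurable_smooth_by.
  - by move=> t; exact: norm_smooth_by.
have mh2 : measurable_fun [set: T] (fun t => 2^-1 * h t ^+ 2).
  by apply: measurable_funM => //; exact: measurable_funX.
have h20 t : 0 <= 2^-1 * h t ^+ 2 by rewrite mulr_ge0 ?sqr_ge0.
rewrite -lee_fin; apply: (@le_trans _ _ (\int[mu]_t `|h t * smooth_by e h t|%:E)%E).
  apply: le_trans (le_normr_Rintegral_EFin Wi).
  by rewrite lee_fin ler_norm.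
pose P t s := poisson e (lam * (t - s)).
have P0 t s : 0 <= P t s by exact/poisson_ge0/ltW.
have mP : measurable_fun [set: T * T] (fun z : T * T => P z.1 z.2).
  exact: measurable_poisson2.
pose L (z : T * T) := 2^-1 * h z.1 ^+ 2 * P z.1 z.2.
pose Q (z : T * T) := 2^-1 * h z.2 ^+ 2 * P z.1 z.2.
have mL : measurable_fun [set: T * T] L.
  by apply: measurable_funM => //; exact: (measurableT_comp mh2 measurable_fst).
have mQ : measurable_fun [set: T * T] Q.
  by apply: measurable_funM => //; exact: (measurableT_comp mh2 measurable_snd).
have L0 z : 0 <= L z by rewrite /L; apply: mulr_ge0.
have Q0 z : 0 <= Q z by rewrite /Q; apply: mulr_ge0.
have mEL : measurable_fun [set: T * T] (EFin \o L) by exact/measurable_EFinP.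
have mEQ : measurable_fun [set: T * T] (EFin \o Q) by exact/measurable_EFinP.
have mL1 t : measurable_fun [set: T] (fun s => L (t, s)).
  exact: (measurableT_comp mL (measurable_pair1 t)).
have mQ1 t : measurable_fun [set: T] (fun s => Q (t, s)).
  exact: (measurableT_comp mQ (measurable_pair1 t)).
apply: (@le_trans _ _ (\int[mu]_t
   (\int[mu]_s (L (t, s))%:E + \int[mu]_s (Q (t, s))%:E))%E).
  apply: ge0_le_integral => //.
  - by apply/measurable_EFinP; apply: measurableT_comp => //; exact: integrable_EFin_measurable Wi.
  - apply: emeasurable_funD.
      exact: (measurable_fun_fubini_tonelli_F (EFin \o L)).
    exact: (measurable_fun_fubini_tonelli_F (EFin \o Q)).
  - move=> t _; rewrite -integral_EFinD//.
    rewrite /smooth_by -RintegralZl//; last exact: integrable_poisson_conv.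
    apply: le_trans (le_normr_Rintegral_EFin _) _.
      by apply: integrable_EFinZ; exact: integrable_poisson_conv.
    apply: le_integral_EFin => //.
    + apply: measurableT_comp => //; apply: measurable_funM => //.
      by apply: integrable_EFin_measurable; exact: integrable_poisson_conv.
    + exact: measurable_funD.
    + move=> s; rewrite /L /Q /= -mulrDl mulrA normrM (ger0_norm (P0 t s)).
      rewrite ler_wpM2r// normrM -mulrDr.
      rewrite -(real_normK (num_real (h t))) -(real_normK (num_real (h s))).
      have := sqr_ge0 (`|h t| - `|h s|); nra.
rewrite ge0_integralD//; last 4 first.
- by move=> t _; apply: integral_ge0 => s _; rewrite lee_fin.
- exact: (measurable_fun_fubini_tonelli_F (EFin \o L)).
- by move=> t _; apply: integral_ge0 => s _; rewrite lee_fin.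
- exact: (measurable_fun_fubini_tonelli_F (EFin \o Q)).
rewrite [X in (X + _)%E](integral_poisson_left e0 mh2 h20).
rewrite [X in (_ + X)%E](integral_poisson_right e0 mh2 h20).
rewrite integral_EFinZ//;
  [|exact: measurable_funX|by move=> t; exact: sqr_ge0].
rewrite EFin_Rintegral// -!EFinM -EFinD lee_fin -mulrDr -mulrDl.
by rewrite (_ : 2^-1 + 2^-1 = 1 :> R) ?mul1r//; field.
Qed.

(** Since the kernel has mass K, the value K (p t) minus the Poisson mean at t
    is the integral of p t - p s against the kernel. *)
Lemma energy_defect (e N : R) (E : set T) p h : 0 < e -> 0 <= N ->
  measurable E -> itg p -> itg h -> (forall t, `|h t| <= N * \1_E t) ->
  (`|K * (\int[mu]_t (h t * p t)) - energy e h p|%:E <=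
   N%:E * \int[mu]_t \int[mu]_s
    (\1_E t * `|p t - p s| * poisson e (lam * (t - s)))%:E)%E.
Proof.
move=> e0 N0 mE ip ih hN; rewrite energyE//.
have hM t : `|h t| <= N.
  by rewrite (le_trans (hN t))// ler_piMr// indicE; case: (_ \in _).
have [mp mh] := (integrable_EFin_measurable ip, integrable_EFin_measurable ih).
have hpi : itg (fun t => h t * p t).
  rewrite (_ : (fun t => _) = (fun t => p t * h t)); last first.
    by apply/funext => t; rewrite mulrC.
  exact: (@integrable_mul_bounded _ _ _ _ _ _ N).
have Wi : itg (fun t => h t * smooth_by e p t).
  apply: (@integrable_mul_bounded _ _ _ _ _ _ (norm1 p * (2 / e))) => //.
  - exact: measurable_smooth_by.
  - by move=> t; exact: norm_smooth_by.
have Ki := integrable_EFinZ K hpi.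
rewrite -RintegralZl// -RintegralB//.
have di := integrable_EFinB Ki Wi.
apply: (le_trans (le_normr_Rintegral_EFin di)).
pose F (z : T * T) := \1_E z.1 * `|p z.1 - p z.2| * poisson e (lam * (z.1 - z.2)).
have mF : measurable_fun [set: T * T] F.
  apply: measurable_funM; last exact: measurable_poisson2.
  apply: measurable_funM.
    by apply: (measurableT_comp _ measurable_fst); exact: measurable_indic.
  apply: measurableT_comp => //; apply: measurable_funB.
    exact: (measurableT_comp mp measurable_fst).
  exact: (measurableT_comp mp measurable_snd).
have F0 z : 0 <= F z.
  by apply: mulr_ge0; [exact: mulr_ge0|exact/poisson_ge0/ltW].
have mEF : measurable_fun [set: T * T] (EFin \o F) by exact/measurable_EFinP.
have mF1 t : measurable_fun [set: T] (fun s => F (t, s)).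
  exact: (measurableT_comp mF (measurable_pair1 t)).
rewrite -ge0_integralZl//; last 2 first.
- exact: (measurable_fun_fubini_tonelli_F (EFin \o F)).
- by move=> t _; apply: integral_ge0 => s _; rewrite lee_fin; exact: (F0 (t, s)).
apply: ge0_le_integral => //.
- by apply/measurable_EFinP; apply: measurableT_comp => //; exact: integrable_EFin_measurable di.
- apply: emeasurable_funM => //.
  exact: (measurable_fun_fubini_tonelli_F (EFin \o F)).
move=> t _; rewrite -integral_EFinZ//; [|exact: mF1|by move=> s; exact: (F0 (t, s))].
have PKi := integrable_poisson_sub t e0.
have cvi := integrable_poisson_conv t e0 ip.
have KE : K = \int[mu]_s poisson e (lam * (t - s)).
  by rewrite /Rintegral integral_poisson.
rewrite {1}KE mulrCA -mulrBr [_ * p t]mulrC -RintegralZl//.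
have pPi := integrable_EFinZ (p t) PKi.
rewrite /smooth_by -RintegralB// -RintegralZl//; last exact: integrable_EFinB.
apply: le_trans (le_normr_Rintegral_EFin _) _.
  by apply: integrable_EFinZ; exact: integrable_EFinB.
apply: le_integral_EFin => //.
- apply: measurableT_comp => //; apply: measurable_funM => //.
  apply: measurable_funB; [exact: integrable_EFin_measurable pPi|exact: integrable_EFin_measurable cvi].
- by apply: measurable_funM => //; exact: mF1.
move=> s; have P0 : 0 <= poisson e (lam * (t - s)) by exact/poisson_ge0/ltW.
rewrite /F /= -mulrBl mulrA normrM (ger0_norm P0) normrM.
rewrite [leRHS](_ : _ = (N * \1_E t) * `|p t - p s| * poisson e (lam * (t - s))); last by ring.
by rewrite ler_wpM2r// ler_wpM2r.
Qed.

End real_plancherel.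

Section plancherel.
Context {R : realType}.
Local Notation mu := (@lebesgue_measure R).
Local Notation T := (measurableTypeR R).
Local Notation itg f := (mu.-integrable setT (EFin \o f)).
Variable lam : R.
Hypothesis lam0 : lam != 0.
Implicit Types p q h : R -> R.
Local Notation K := (2 * pi / `|lam|).
Local Notation cosT := (cosT lam).
Local Notation sinT := (sinT lam).

Let K0 : 0 < K.
Proof. by rewrite !mulr_gt0 ?pi_gt0// invr_gt0 normr_gt0. Qed.

(** The condition h p = h ^ 2 is met by truncations of p.  With H the square
    norm of h and I the right-hand side, the four estimates on energies combine
    to 2 K H <= I + K H + eta for every eta > 0. *)
Lemma plancherel_truncated p h (N : R) : itg p -> itg h -> 0 < N ->
  (forall t, `|h t| <= N * \1_(`[-N, N]%classic) t) ->
  (forall t, h t * p t = h t ^+ 2) ->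
  (K%:E * \int[mu]_t (h t ^+ 2)%:E <=
   \int[mu]_u (cosT p u ^+ 2 + sinT p u ^+ 2)%:E)%E.
Proof.
move=> ip ih N0 hN hp.
have hM t : `|h t| <= N.
  by rewrite (le_trans (hN t))// ler_piMr// ?ltW// indicE; case: (_ \in _).
have h2i := integrable_sqr ih hM.
rewrite (EFin_Rintegral h2i) -EFinM.
set X := (\int[mu]_u _)%E; set H := Rintegral _ _ _.
have X0 : (0 <= X)%E.
  by apply: integral_EFin_ge0 => u; rewrite addr_ge0 ?sqr_ge0.
have [->|Xfin] := eqVneq X +oo%E; first exact: leey.
have XE : X = (fine X)%:E by rewrite fineK// ge0_fin_numE// lt_neqAle Xfin leey.
rewrite XE lee_fin; apply/ler_addgt0Pr => eta eta0.
have eta20 : 0 < eta / (2 * N) by rewrite divr_gt0// mulr_gt0.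
have [e e0 He] := smoothing_defect lam0 ip N0 eta20.
have D : `|K * H - energy lam e h p| <= eta / 2.
  rewrite -lee_fin /H; under eq_Rintegral do rewrite -hp.
  have := energy_defect lam0 e0 (ltW N0) (measurable_itv `[-N, N]) ip ih hN.
  move/le_trans; apply.
  apply: (@le_trans _ _ (N%:E * (eta / (2 * N))%:E)%E).
    by apply: lee_wpmul2l; [rewrite lee_fin ltW|exact: He].
  rewrite -EFinM lee_fin le_eqVlt; apply/orP; left; apply/eqP; field.
  by rewrite gt_eqF.
have E1 := energy_polarization lam e0 ip ih.
have E2 := energy_le_L2 lam0 e0 ih hM.
have E3 : energy lam e p p <= fine X by rewrite -lee_fin -XE; exact: energy_le.
rewrite energyC in E1.
move: D E1 E2 E3; rewrite ler_norml -/H => /andP[_].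
set k := K * H; set a := energy _ _ _ _; set b := energy _ _ _ _; set c := energy _ _ _ _.
lra.
Qed.

(** Cut p off where |p| or |t| is large; the truncations increase to p. *)
Lemma plancherel_le p : itg p ->
  (K%:E * \int[mu]_t (p t ^+ 2)%:E <=
   \int[mu]_u (cosT p u ^+ 2 + sinT p u ^+ 2)%:E)%E.
Proof.
move=> ip; have mp := integrable_EFin_measurable ip.
have mnp : measurable_fun [set: T] (fun t => `|p t|) by exact: measurableT_comp.
(* n + 1 instead of n keeps the bound positive *)
pose B (n : nat) : set R :=
  (fun t => `|p t|) @^-1` `]-oo, n.+1%:R] `&` `[- n.+1%:R, n.+1%:R].
have mB n : measurable (B n : set T).
  apply: measurableI; last exact: measurable_itv.
  rewrite -[X in measurable X]setTI; apply: mnp => //; exact: measurable_itv.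
have mi n : measurable_fun [set: T] (\1_(B n) : T -> R) by exact: measurable_indic.
pose h n t := p t * \1_(B n) t.
have ih n : itg (h n).
  apply: (@integrable_mul_bounded _ _ _ _ _ _ 1) => //.
  by move=> t; rewrite indicE; case: (_ \in _); rewrite ?normr1 ?normr0.
have N0 n : 0 < n.+1%:R :> R by [].
have hN n t : `|h n t| <= n.+1%:R * \1_(`[-n.+1%:R, n.+1%:R]%classic) t.
  rewrite /h !indicE; have [|tB] := boolP (t \in B n); last first.
    by rewrite mulr0 normr0 mulr_ge0.
  rewrite inE => -[/= tp tN]; rewrite mulr1 mem_set// mulr1.
  by move: tp; rewrite in_itv.
have hp n t : h n t * p t = h n t ^+ 2.
  by rewrite /h indicE; case: (_ \in _); rewrite ?mulr1 ?mulr0 ?mul0r ?expr0n.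
have step n := plancherel_truncated ip (ih n) (N0 n) (hN n) (hp n).
rewrite -integral_EFinZ//; [|exact: measurable_funX|by move=> t; exact: sqr_ge0|exact: ltW].
have mg n : measurable_fun [set: T] (fun t => (K * h n t ^+ 2)%:E).
  apply/measurable_EFinP; apply: measurable_funM => //.
  by apply: measurable_funX; exact: integrable_EFin_measurable (ih n).
have g0 n t : [set: T] t -> (0 <= (K * h n t ^+ 2)%:E)%E.
  by move=> _; rewrite lee_fin mulr_ge0 ?sqr_ge0// ltW.
have nd t : [set: T] t -> {homo (fun n => (K * h n t ^+ 2)%:E) : n m / (n <= m)%N >-> (n <= m)%E}.
  move=> _ n m nm; rewrite lee_fin ler_wpM2l ?(ltW K0)// /h !indicE.
  have [|] := boolP (t \in B n); last by rewrite mulr0 expr0n sqr_ge0.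
  rewrite inE => -[/= tp tN].
  have nmR : n.+1%:R <= m.+1%:R :> R by rewrite ler_nat.
  rewrite (mem_set (A := B m))//; split; move: tp tN; rewrite /= !in_itv/=.
    by move=> /le_trans H _; exact: H.
  by move=> _ /andP[? ?]; apply/andP; split; lra.
have cv := @cvg_monotone_convergence _ _ _ mu _ measurableT _ mg g0 nd.
have lim_h t : limn (fun n => (K * h n t ^+ 2)%:E) = (K * p t ^+ 2)%:E.
  apply/cvg_lim => //; apply: cvg_near_cst.
  have [k kt] : exists k : nat, Num.max `|p t| `|t| <= k%:R.
    by exists (Num.bound (Num.max `|p t| `|t|)); rewrite ltW// archi_boundP// le_max normr_ge0.
  exists k => // n /= kn; congr (_ * _)%:E; rewrite /h indicE mem_set ?mulr1//.
  have kn' : k%:R <= n.+1%:R :> R by rewrite ler_nat ltnW.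
  move: kt; rewrite ge_max => /andP[k1 k2]; split => /=.
    by rewrite in_itv/= (le_trans k1).
  by rewrite in_itv/= -ler_norml (le_trans k2).
under eq_integral => t _ do rewrite -lim_h.
rewrite -(cvg_lim _ cv)//.
apply: lime_le; first by apply/cvg_ex; eexists; exact: cv.
apply: nearW => n; rewrite integral_EFinZ//.
- by apply: measurable_funX; exact: integrable_EFin_measurable (ih n).
- by move=> t; exact: sqr_ge0.
- exact: ltW.
Qed.

(** The transform of p + i q is [cfourier p q] + i [sfourier p q]. *)
Definition cfourier p q u := cosT p u + sinT q u.
Definition sfourier p q u := cosT q u - sinT p u.

Lemma cosTN p u : cosT p (- u) = cosT p u.
Proof. by apply: eq_Rintegral => t _; rewrite mulrN mulNr cosN. Qed.

Lemma sinTN p u : itg p -> sinT p (- u) = - sinT p u.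
Proof.
move=> ip.
have -> : - sinT p u = \int[mu]_t (-1 * (p t * sin (lam * u * t))).
  by rewrite RintegralZl ?mulN1r//; exact: integrable_sin.
apply: eq_Rintegral => t _.
have -> : lam * - u * t = - (lam * u * t) by ring.
by rewrite sinN mulrN mulN1r.
Qed.

Lemma measurable_cfourier p q : measurable_fun [set: T] p ->
  measurable_fun [set: T] q -> measurable_fun [set: T] (cfourier p q).
Proof.
by move=> mp mq; apply: measurable_funD; [exact: measurable_cosT|exact: measurable_sinT].
Qed.

Lemma measurable_sfourier p q : measurable_fun [set: T] p ->
  measurable_fun [set: T] q -> measurable_fun [set: T] (sfourier p q).
Proof.
by move=> mp mq; apply: measurable_funB; [exact: measurable_cosT|exact: measurable_sinT].
Qed.

Lemma half_eD (y : \bar R) : (0 <= y)%E ->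
  ((2^-1)%:E * y + (2^-1)%:E * y = y)%E.
Proof.
move=> y0; rewrite -ge0_muleDl ?lee_fin ?invr_ge0// -EFinD.
by rewrite (_ : 2^-1 + 2^-1 = 1 :> R) ?mul1e//; field.
Qed.

(** The cross terms between p and q in the square modulus are odd in u, so
    they cancel in the average over u and - u. *)
Lemma complex_plancherel_le p q : itg p -> itg q ->
  (K%:E * \int[mu]_t (p t ^+ 2 + q t ^+ 2)%:E <=
   \int[mu]_u (cfourier p q u ^+ 2 + sfourier p q u ^+ 2)%:E)%E.
Proof.
move=> ip iq; have [mp mq] := (integrable_EFin_measurable ip, integrable_EFin_measurable iq).
pose X u := cfourier p q u ^+ 2 + sfourier p q u ^+ 2.
have X0 u : 0 <= X u by rewrite addr_ge0 ?sqr_ge0.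
have mX : measurable_fun [set: T] X.
  by apply: measurable_funD; apply: measurable_funX;
    [exact: measurable_cfourier|exact: measurable_sfourier].
pose A r u := cosT r u ^+ 2 + sinT r u ^+ 2.
have A0 r u : 0 <= A r u by rewrite addr_ge0 ?sqr_ge0.
have mA r : measurable_fun [set: T] r -> measurable_fun [set: T] (A r).
  by move=> mr; apply: measurable_funD; apply: measurable_funX;
    [exact: measurable_cosT|exact: measurable_sinT].
have XN : (\int[mu]_u (X (- u))%:E = \int[mu]_u (X u)%:E)%E.
  by rewrite (@ge0_integral_reflection _ (fun u => (X u)%:E))//; exact/measurable_EFinP.
have mXN : measurable_fun [set: T] (fun u : T => X (- u)).
  exact: (measurableT_comp mX measurable_opp).
have XA : (\int[mu]_u (X u)%:E = \int[mu]_u (A p u)%:E + \int[mu]_u (A q u)%:E)%E.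
  have AE := integral_EFinD mu (mA p mp) (mA q mq) (A0 p) (A0 q).
  rewrite -[RHS]AE.
  pose Y u := 2^-1 * X u; pose Z u := 2^-1 * X (- u).
  have mY : measurable_fun [set: T] Y by exact: measurable_funM.
  have mZ : measurable_fun [set: T] Z by exact: measurable_funM.
  have Y0 u : 0 <= Y u by exact: mulr_ge0.
  have Z0 u : 0 <= Z u by exact: mulr_ge0.
  transitivity (\int[mu]_u (Y u + Z u)%:E)%E; last first.
    apply: eq_integral => u _; congr EFin.
    by rewrite /Y /Z /X /A /cfourier /sfourier !cosTN !sinTN//; field.
  have YZ := integral_EFinD mu mY mZ Y0 Z0.
  have ZX : (\int[mu]_u (Z u)%:E = (2^-1)%:E * \int[mu]_u (X u)%:E)%E.
    by rewrite -XN; apply: integral_EFinZ => //; rewrite invr_ge0.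
  have YX : (\int[mu]_u (Y u)%:E = (2^-1)%:E * \int[mu]_u (X u)%:E)%E.
    by apply: integral_EFinZ => //; rewrite invr_ge0.
  have IX0 : (0 <= \int[mu]_u (X u)%:E)%E := integral_EFin_ge0 mu X0.
  by rewrite [RHS]YZ YX ZX; move: IX0; move: (integral _ _ _) => y y0;
    rewrite half_eD.
rewrite XA.
have mp2 : measurable_fun [set: T] (fun t => p t ^+ 2) by exact: measurable_funX.
have mq2 : measurable_fun [set: T] (fun t => q t ^+ 2) by exact: measurable_funX.
have p2 t : 0 <= p t ^+ 2 by exact: sqr_ge0.
have q2 t : 0 <= q t ^+ 2 by exact: sqr_ge0.
rewrite [X in (_ * X)%E](integral_EFinD mu mp2 mq2 p2 q2).
rewrite (ge0_muleDr _ (integral_EFin_ge0 mu p2) (integral_EFin_ge0 mu q2)).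
by apply: leeD; exact: plancherel_le.
Qed.

End plancherel.

(** * Plancherel's inequality in the plane *)

Section fourier2.
Context {R : realType}.
Local Notation mu := (@lebesgue_measure R).
Local Notation mu2 := (@lebesgue_measure R \x @lebesgue_measure R)%E.
Local Notation T := (measurableTypeR R).
Local Notation itg f := (mu.-integrable setT (EFin \o f)).
Local Notation itg2 f := (mu2.-integrable setT (EFin \o f)).
Implicit Types p q : T * T -> R.

Lemma integrable_Rintegral_left (f : T * T -> R) : itg2 f ->
  itg (fun y => \int[mu]_x f (x, y)).
Proof.
move=> fi; have /integrableP[/measurable_EFinP mf _] := fi.
have foo := (integrable21ltyP mu mu (measurable_int _ fi)).1 fi.
apply/integrableP; split.
  by apply/measurable_EFinP; exact: measurable_fun_Rintegral_swap.
apply: le_lt_trans foo; apply: ge0_le_integral => //.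
- apply: measurableT_comp => //; apply/measurable_EFinP.
  exact: measurable_fun_Rintegral_swap.
- apply: (measurable_fun_fubini_tonelli_G (abse \o (EFin \o f))).
    by apply: measurableT_comp => //; exact/measurable_EFinP.
  by move=> z; rewrite /= lee_fin.
- move=> y _; apply: normr_Rintegral_le.
  exact: (measurableT_comp mf (measurable_pair2 y)).
Qed.

(** The constant k2 y enters the inner integral wherever the section of p is
    integrable, hence almost everywhere. *)
Lemma Rintegral_iterated_kernel p (k1 k2 : R -> R) : itg2 p ->
  measurable_fun [set: T] k1 -> measurable_fun [set: T] k2 ->
  (forall x, `|k1 x| <= 1) -> (forall x, `|k2 x| <= 1) ->
  \int[mu]_y ((\int[mu]_x (p (x, y) * k1 x)) * k2 y) =
  \int[mu2]_t (p t * (k1 t.1 * k2 t.2)).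
Proof.
move=> ip mk1 mk2 k11 k21.
have /integrableP[/measurable_EFinP mp _] := ip.
have mk1' : measurable_fun [set: T * T] (fun t : T * T => k1 t.1).
  exact: (measurableT_comp mk1 measurable_fst).
have mk2' : measurable_fun [set: T * T] (fun t : T * T => k2 t.2).
  exact: (measurableT_comp mk2 measurable_snd).
have ki : itg2 (fun t => p t * (k1 t.1 * k2 t.2)).
  apply: (@integrable_mul_bounded _ _ _ _ _ _ 1) => //.
    exact: measurable_funM.
  by move=> t; rewrite normrM mulr_ile1.
rewrite -(Rintegral_prod2 ki).
have mpk1 : measurable_fun [set: T * T] (fun t : T * T => p t * k1 t.1).
  exact: measurable_funM.
apply: Rintegral_ae_eq.
- apply: measurable_funM => //.
  exact: (measurable_fun_Rintegral_swap mu mpk1).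
- have /integrableP[/measurable_EFinP mki _] := ki.
  exact: (measurable_fun_Rintegral_swap mu mki).
apply: filterS (ae_integrable2 ip) => y pyi.
rewrite -RintegralZr//; last first.
  exact: (@integrable_mul_bounded _ _ _ _ (fun x => p (x, y)) k1 1).
by apply: eq_Rintegral => x _; rewrite mulrA.
Qed.

Variables lam1 lam2 : R.
Hypotheses (lam10 : lam1 != 0) (lam20 : lam2 != 0).

Definition phase2 (u t : R * R) := lam1 * u.1 * t.1 + lam2 * u.2 * t.2.

Definition cfourier2 p q (u : R * R) : R :=
  \int[mu2]_t (p t * cos (phase2 u t) + q t * sin (phase2 u t)).

Definition sfourier2 p q (u : R * R) : R :=
  \int[mu2]_t (q t * cos (phase2 u t) - p t * sin (phase2 u t)).

Let c1 p q (u1 t2 : R) :=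
  cfourier lam1 (fun t1 => p (t1, t2)) (fun t1 => q (t1, t2)) u1.
Let s1 p q (u1 t2 : R) :=
  sfourier lam1 (fun t1 => p (t1, t2)) (fun t1 => q (t1, t2)) u1.

Lemma measurable_phase2 u : measurable_fun [set: T * T] (phase2 u).
Proof.
apply: measurable_funD.
- exact: (measurableT_comp (measurable_scale (lam1 * u.1)) measurable_fst).
- exact: (measurableT_comp (measurable_scale (lam2 * u.2)) measurable_snd).
Qed.

Lemma integrable2_cos p (f : T * T -> R) : itg2 p -> measurable_fun [set: T * T] f ->
  itg2 (fun t => p t * cos (f t)).
Proof.
move=> ip mf; apply: (@integrable_mul_bounded _ _ _ _ _ _ 1) => //.
  exact: measurable_cosF.
by move=> t; exact: cos_max.
Qed.

Lemma integrable2_sin p (f : T * T -> R) : itg2 p -> measurable_fun [set: T * T] f ->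
  itg2 (fun t => p t * sin (f t)).
Proof.
move=> ip mf; apply: (@integrable_mul_bounded _ _ _ _ _ _ 1) => //.
  exact: measurable_sinF.
by move=> t; exact: sin_max.
Qed.

Let ph1 (u1 : R) : measurable_fun [set: T * T] (fun t : T * T => lam1 * u1 * t.1).
Proof. exact: (measurableT_comp (measurable_scale (lam1 * u1)) measurable_fst). Qed.

Lemma integrable_cosT_section p u1 : itg2 p ->
  itg (fun t2 => cosT lam1 (fun t1 => p (t1, t2)) u1).
Proof.
move=> ip.
exact: (@integrable_Rintegral_left _ (integrable2_cos ip (ph1 u1))).
Qed.

Lemma integrable_sinT_section p u1 : itg2 p ->
  itg (fun t2 => sinT lam1 (fun t1 => p (t1, t2)) u1).
Proof.
move=> ip.
exact: (@integrable_Rintegral_left _ (integrable2_sin ip (ph1 u1))).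
Qed.

Lemma integrable_c1 p q u1 : itg2 p -> itg2 q -> itg (c1 p q u1).
Proof.
move=> ip iq; apply: integrable_EFinD.
- exact: integrable_cosT_section.
- exact: integrable_sinT_section.
Qed.

Lemma integrable_s1 p q u1 : itg2 p -> itg2 q -> itg (s1 p q u1).
Proof.
move=> ip iq; apply: integrable_EFinB.
- exact: integrable_cosT_section.
- exact: integrable_sinT_section.
Qed.

Let mcos (l u : R) : measurable_fun [set: T] (fun t : T => cos (l * u * t)).
Proof. by apply: measurable_cosF; exact: measurable_scale. Qed.

Let msin (l u : R) : measurable_fun [set: T] (fun t : T => sin (l * u * t)).
Proof. by apply: measurable_sinF; exact: measurable_scale. Qed.

Lemma cosTD l (f g : R -> R) u : itg f -> itg g ->
  cosT l (fun t => f t + g t) u = cosT l f u + cosT l g u.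
Proof.
move=> fi gi; rewrite /cosT -RintegralD//; [|exact: integrable_cos..].
by apply: eq_Rintegral => t _; rewrite mulrDl.
Qed.

Lemma cosTB l (f g : R -> R) u : itg f -> itg g ->
  cosT l (fun t => f t - g t) u = cosT l f u - cosT l g u.
Proof.
move=> fi gi; rewrite /cosT -RintegralB//; [|exact: integrable_cos..].
by apply: eq_Rintegral => t _; rewrite mulrBl.
Qed.

Lemma sinTD l (f g : R -> R) u : itg f -> itg g ->
  sinT l (fun t => f t + g t) u = sinT l f u + sinT l g u.
Proof.
move=> fi gi; rewrite /sinT -RintegralD//; [|exact: integrable_sin..].
by apply: eq_Rintegral => t _; rewrite mulrDl.
Qed.

Lemma sinTB l (f g : R -> R) u : itg f -> itg g ->
  sinT l (fun t => f t - g t) u = sinT l f u - sinT l g u.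
Proof.
move=> fi gi; rewrite /sinT -RintegralB//; [|exact: integrable_sin..].
by apply: eq_Rintegral => t _; rewrite mulrBl.
Qed.

Let kernel_itg p (k1 k2 : R -> R) : itg2 p ->
  measurable_fun [set: T] k1 -> measurable_fun [set: T] k2 ->
  (forall x, `|k1 x| <= 1) -> (forall x, `|k2 x| <= 1) ->
  itg2 (fun t => p t * (k1 t.1 * k2 t.2)).
Proof.
move=> ip mk1 mk2 k11 k21.
apply: (@integrable_mul_bounded _ _ _ _ _ _ 1) => //.
  apply: measurable_funM; first exact: (measurableT_comp mk1 measurable_fst).
  exact: (measurableT_comp mk2 measurable_snd).
by move=> t; rewrite normrM mulr_ile1.
Qed.

Let nc (l u x : R) : `|cos (l * u * x)| <= 1. Proof. exact: cos_max. Qed.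
Let ns (l u x : R) : `|sin (l * u * x)| <= 1. Proof. exact: sin_max. Qed.

(** In the names of the four product formulas the outer transform comes first:
    c for cosine, s for sine. *)
Let kcc p (u : R * R) : itg2 p ->
  cosT lam2 (fun t2 => cosT lam1 (fun t1 => p (t1, t2)) u.1) u.2 =
  \int[mu2]_t (p t * (cos (lam1 * u.1 * t.1) * cos (lam2 * u.2 * t.2))).
Proof.
by move=> ip; exact: (Rintegral_iterated_kernel ip (mcos lam1 u.1)
  (mcos lam2 u.2) (nc lam1 u.1) (nc lam2 u.2)).
Qed.

Let kcs p (u : R * R) : itg2 p ->
  cosT lam2 (fun t2 => sinT lam1 (fun t1 => p (t1, t2)) u.1) u.2 =
  \int[mu2]_t (p t * (sin (lam1 * u.1 * t.1) * cos (lam2 * u.2 * t.2))).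
Proof.
by move=> ip; exact: (Rintegral_iterated_kernel ip (msin lam1 u.1)
  (mcos lam2 u.2) (ns lam1 u.1) (nc lam2 u.2)).
Qed.

Let ksc p (u : R * R) : itg2 p ->
  sinT lam2 (fun t2 => cosT lam1 (fun t1 => p (t1, t2)) u.1) u.2 =
  \int[mu2]_t (p t * (cos (lam1 * u.1 * t.1) * sin (lam2 * u.2 * t.2))).
Proof.
by move=> ip; exact: (Rintegral_iterated_kernel ip (mcos lam1 u.1)
  (msin lam2 u.2) (nc lam1 u.1) (ns lam2 u.2)).
Qed.

Let kss p (u : R * R) : itg2 p ->
  sinT lam2 (fun t2 => sinT lam1 (fun t1 => p (t1, t2)) u.1) u.2 =
  \int[mu2]_t (p t * (sin (lam1 * u.1 * t.1) * sin (lam2 * u.2 * t.2))).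
Proof.
by move=> ip; exact: (Rintegral_iterated_kernel ip (msin lam1 u.1)
  (msin lam2 u.2) (ns lam1 u.1) (ns lam2 u.2)).
Qed.

Lemma cfourier2E p q u : itg2 p -> itg2 q ->
  cfourier2 p q u = cfourier lam2 (c1 p q u.1) (s1 p q u.1) u.2.
Proof.
move=> ip iq; rewrite /cfourier /c1 /s1 /cfourier /sfourier.
rewrite cosTD; [|exact: integrable_cosT_section|exact: integrable_sinT_section].
rewrite sinTB; [|exact: integrable_cosT_section|exact: integrable_sinT_section].
rewrite kcc// kcs// ksc// kss//.
have i1 := kernel_itg ip (mcos lam1 u.1) (mcos lam2 u.2) (nc lam1 u.1) (nc lam2 u.2).
have i2 := kernel_itg iq (msin lam1 u.1) (mcos lam2 u.2) (ns lam1 u.1) (nc lam2 u.2).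
have i3 := kernel_itg iq (mcos lam1 u.1) (msin lam2 u.2) (nc lam1 u.1) (ns lam2 u.2).
have i4 := kernel_itg ip (msin lam1 u.1) (msin lam2 u.2) (ns lam1 u.1) (ns lam2 u.2).
have i12 := integrable_EFinD i1 i2; have i34 := integrable_EFinB i3 i4.
rewrite -(RintegralD measurableT i1 i2) -(RintegralB measurableT i3 i4).
rewrite -(RintegralD measurableT i12 i34).
by apply: eq_Rintegral => t _; rewrite /phase2 cosD sinD; ring.
Qed.

Lemma sfourier2E p q u : itg2 p -> itg2 q ->
  sfourier2 p q u = sfourier lam2 (c1 p q u.1) (s1 p q u.1) u.2.
Proof.
move=> ip iq; rewrite /sfourier /c1 /s1 /cfourier /sfourier.
rewrite cosTB; [|exact: integrable_cosT_section|exact: integrable_sinT_section].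
rewrite sinTD; [|exact: integrable_cosT_section|exact: integrable_sinT_section].
rewrite kcc// kcs// ksc// kss//.
have i1 := kernel_itg iq (mcos lam1 u.1) (mcos lam2 u.2) (nc lam1 u.1) (nc lam2 u.2).
have i2 := kernel_itg ip (msin lam1 u.1) (mcos lam2 u.2) (ns lam1 u.1) (nc lam2 u.2).
have i3 := kernel_itg ip (mcos lam1 u.1) (msin lam2 u.2) (nc lam1 u.1) (ns lam2 u.2).
have i4 := kernel_itg iq (msin lam1 u.1) (msin lam2 u.2) (ns lam1 u.1) (ns lam2 u.2).
have i12 := integrable_EFinB i1 i2; have i34 := integrable_EFinD i3 i4.
rewrite -(RintegralB measurableT i1 i2) -(RintegralD measurableT i3 i4).
rewrite -(RintegralB measurableT i12 i34).
by apply: eq_Rintegral => t _; rewrite /phase2 cosD sinD; ring.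
Qed.

Lemma measurable_cosT_section p : measurable_fun [set: T * T] p ->
  measurable_fun [set: T * T] (fun z : T * T => cosT lam1 (fun t1 => p (t1, z.2)) z.1).
Proof.
move=> mp; apply: (@measurable_fun_Rintegral _ _ (T * T)%type T R mu
  (fun w : (T * T) * T => p (w.2, w.1.2) * cos (lam1 * w.1.1 * w.2))).
apply: measurable_funM.
  apply: (measurableT_comp mp); apply: measurable_fun_pair => //.
  exact: (measurableT_comp measurable_snd measurable_fst).
apply: measurable_cosF; apply: (measurableT_comp (measurable_phase lam1)
  (f := fun z : T * T => lam1 * z.1 * z.2) (g := fun w : (T * T) * T => (w.1.1, w.2))).
apply: measurable_fun_pair => //.
exact: (measurableT_comp measurable_fst measurable_fst).
Qed.

Lemma measurable_sinT_section p : measurable_fun [set: T * T] p ->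
  measurable_fun [set: T * T] (fun z : T * T => sinT lam1 (fun t1 => p (t1, z.2)) z.1).
Proof.
move=> mp; apply: (@measurable_fun_Rintegral _ _ (T * T)%type T R mu
  (fun w : (T * T) * T => p (w.2, w.1.2) * sin (lam1 * w.1.1 * w.2))).
apply: measurable_funM.
  apply: (measurableT_comp mp); apply: measurable_fun_pair => //.
  exact: (measurableT_comp measurable_snd measurable_fst).
apply: measurable_sinF; apply: (measurableT_comp (measurable_phase lam1)
  (f := fun z : T * T => lam1 * z.1 * z.2) (g := fun w : (T * T) * T => (w.1.1, w.2))).
apply: measurable_fun_pair => //.
exact: (measurableT_comp measurable_fst measurable_fst).
Qed.

End fourier2.

Section plancherel2.
Context {R : realType}.
Local Notation mu := (@lebesgue_measure R).
Local Notation mu2 := (@lebesgue_measure R \x @lebesgue_measure R)%E.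
Local Notation T := (measurableTypeR R).
Local Notation itg f := (mu.-integrable setT (EFin \o f)).
Local Notation itg2 f := (mu2.-integrable setT (EFin \o f)).
Implicit Types p q : T * T -> R.
Variables lam1 lam2 : R.

Lemma measurable_cosT_section1 (l : R) (f : T * T -> R) :
  measurable_fun [set: T * T] f ->
  measurable_fun [set: T * T] (fun z : T * T => cosT l (fun t => f (z.1, t)) z.2).
Proof.
move=> mf; apply: (@measurable_fun_Rintegral _ _ (T * T)%type T R mu
  (fun w : (T * T) * T => f (w.1.1, w.2) * cos (l * w.1.2 * w.2))).
apply: measurable_funM.
  apply: (measurableT_comp mf); apply: measurable_fun_pair => //.
  exact: (measurableT_comp measurable_fst measurable_fst).
apply: measurable_cosF; apply: (measurableT_comp (measurable_phase l)
  (f := fun z : T * T => l * z.1 * z.2) (g := fun w : (T * T) * T => (w.1.2, w.2))).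
apply: measurable_fun_pair => //.
exact: (measurableT_comp measurable_snd measurable_fst).
Qed.

Lemma measurable_sinT_section1 (l : R) (f : T * T -> R) :
  measurable_fun [set: T * T] f ->
  measurable_fun [set: T * T] (fun z : T * T => sinT l (fun t => f (z.1, t)) z.2).
Proof.
move=> mf; apply: (@measurable_fun_Rintegral _ _ (T * T)%type T R mu
  (fun w : (T * T) * T => f (w.1.1, w.2) * sin (l * w.1.2 * w.2))).
apply: measurable_funM.
  apply: (measurableT_comp mf); apply: measurable_fun_pair => //.
  exact: (measurableT_comp measurable_fst measurable_fst).
apply: measurable_sinF; apply: (measurableT_comp (measurable_phase l)
  (f := fun z : T * T => l * z.1 * z.2) (g := fun w : (T * T) * T => (w.1.2, w.2))).
apply: measurable_fun_pair => //.
exact: (measurableT_comp measurable_snd measurable_fst).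
Qed.

Lemma measurable_c1 p q : measurable_fun [set: T * T] p ->
  measurable_fun [set: T * T] q ->
  measurable_fun [set: T * T] (fun z : T * T =>
    cfourier lam1 (fun t => p (t, z.2)) (fun t => q (t, z.2)) z.1).
Proof.
by move=> mp mq; apply: measurable_funD;
  [exact: measurable_cosT_section|exact: measurable_sinT_section].
Qed.

Lemma measurable_s1 p q : measurable_fun [set: T * T] p ->
  measurable_fun [set: T * T] q ->
  measurable_fun [set: T * T] (fun z : T * T =>
    sfourier lam1 (fun t => p (t, z.2)) (fun t => q (t, z.2)) z.1).
Proof.
by move=> mp mq; apply: measurable_funB;
  [exact: measurable_cosT_section|exact: measurable_sinT_section].
Qed.

Lemma measurable_cfourier2 p q : itg2 p -> itg2 q ->
  measurable_fun [set: T * T] (cfourier2 lam1 lam2 p q : T * T -> R).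
Proof.
move=> ip iq.
have /integrableP[/measurable_EFinP mp _] := ip.
have /integrableP[/measurable_EFinP mq _] := iq.
have -> : cfourier2 lam1 lam2 p q = fun u => cfourier lam2
    (fun t2 => cfourier lam1 (fun t1 => p (t1, t2)) (fun t1 => q (t1, t2)) u.1)
    (fun t2 => sfourier lam1 (fun t1 => p (t1, t2)) (fun t1 => q (t1, t2)) u.1) u.2.
  by apply/funext => u; exact: cfourier2E.
apply: measurable_funD.
- exact: (measurable_cosT_section1 lam2 (measurable_c1 mp mq)).
- exact: (measurable_sinT_section1 lam2 (measurable_s1 mp mq)).
Qed.

Lemma measurable_sfourier2 p q : itg2 p -> itg2 q ->
  measurable_fun [set: T * T] (sfourier2 lam1 lam2 p q : T * T -> R).
Proof.
move=> ip iq.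
have /integrableP[/measurable_EFinP mp _] := ip.
have /integrableP[/measurable_EFinP mq _] := iq.
have -> : sfourier2 lam1 lam2 p q = fun u => sfourier lam2
    (fun t2 => cfourier lam1 (fun t1 => p (t1, t2)) (fun t1 => q (t1, t2)) u.1)
    (fun t2 => sfourier lam1 (fun t1 => p (t1, t2)) (fun t1 => q (t1, t2)) u.1) u.2.
  by apply/funext => u; exact: sfourier2E.
apply: measurable_funB.
- exact: (measurable_cosT_section1 lam2 (measurable_s1 mp mq)).
- exact: (measurable_sinT_section1 lam2 (measurable_c1 mp mq)).
Qed.

Hypotheses (lam10 : lam1 != 0) (lam20 : lam2 != 0).

(** The inequality on the line is applied in the first variable for almost
    every value of the second, and then in the second variable.  The function
    obtained in between is integrable in the second variable but possibly not
    square integrable, which is why the inequality on the line has to hold for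
    all integrable functions. *)
Lemma plancherel2_le p q : itg2 p -> itg2 q ->
  ((2 * pi / `|lam2| * (2 * pi / `|lam1|))%:E * \int[mu2]_t (p t ^+ 2 + q t ^+ 2)%:E <=
   \int[mu2]_u (cfourier2 lam1 lam2 p q u ^+ 2 + sfourier2 lam1 lam2 p q u ^+ 2)%:E)%E.
Proof.
move=> ip iq.
have /integrableP[/measurable_EFinP mp _] := ip.
have /integrableP[/measurable_EFinP mq _] := iq.
have K0 (l : R) : 0 <= 2 * pi / `|l| :> R by rewrite divr_ge0// mulr_ge0// pi_ge0.
set K1 := 2 * pi / `|lam1|; set K2 := 2 * pi / `|lam2|.
pose sec (f : T * T -> R) (t2 : R) : R -> R := fun t1 => f (t1, t2).
have msec f t2 : measurable_fun [set: T * T] f -> measurable_fun [set: T] (sec f t2).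
  by move=> mf; exact: (measurableT_comp mf (measurable_pair2 t2)).
pose A (t : T * T) := p t ^+ 2 + q t ^+ 2.
have A0 t : 0 <= A t by rewrite addr_ge0 ?sqr_ge0.
have mA : measurable_fun [set: T * T] A.
  by apply: measurable_funD; exact: measurable_funX.
have mEA : measurable_fun [set: T * T] (EFin \o A) by exact/measurable_EFinP.
pose c (z : T * T) := cfourier lam1 (sec p z.2) (sec q z.2) z.1.
pose s (z : T * T) := sfourier lam1 (sec p z.2) (sec q z.2) z.1.
have mc : measurable_fun [set: T * T] c.
  exact: measurable_c1.
have ms : measurable_fun [set: T * T] s.
  exact: measurable_s1.
pose B (z : T * T) := c z ^+ 2 + s z ^+ 2.
have B0 z : 0 <= B z by rewrite addr_ge0 ?sqr_ge0.
have mB : measurable_fun [set: T * T] B.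
  by apply: measurable_funD; exact: measurable_funX.
have mEB : measurable_fun [set: T * T] (EFin \o B) by exact/measurable_EFinP.
pose F (u : T * T) := cfourier2 lam1 lam2 p q u ^+ 2 + sfourier2 lam1 lam2 p q u ^+ 2.
have F0 z : 0 <= F z by rewrite addr_ge0 ?sqr_ge0.
have mF : measurable_fun [set: T * T] F.
  by apply: measurable_funD; apply: measurable_funX;
    [exact: measurable_cfourier2|exact: measurable_sfourier2].
have mEF : measurable_fun [set: T * T] (EFin \o F) by exact/measurable_EFinP.
have EA0 z : (0 <= (EFin \o A) z)%E by rewrite lee_fin.
have EB0 z : (0 <= (EFin \o B) z)%E by rewrite lee_fin.
have EF0 z : (0 <= (EFin \o F) z)%E by rewrite lee_fin.
have mFA := @measurable_fun_fubini_tonelli_G _ _ T T R mu (EFin \o A) mEA EA0.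
have mFB := @measurable_fun_fubini_tonelli_G _ _ T T R mu (EFin \o B) mEB EB0.
have mFB' := @measurable_fun_fubini_tonelli_F _ _ T T R mu (EFin \o B) mEB EB0.
have mFF := @measurable_fun_fubini_tonelli_F _ _ T T R mu (EFin \o F) mEF EF0.
have IA := @fubini_tonelli2 _ _ T T R mu mu (EFin \o A) mEA EA0.
have IF := @fubini_tonelli1 _ _ T T R mu mu (EFin \o F) mEF EF0.
have IB := @fubini_tonelli _ _ T T R mu mu (EFin \o B) mEB EB0.
have GA t2 : (0 <= fubini_G mu (EFin \o A) t2)%E by exact: integral_ge0.
have GB t2 : (0 <= fubini_G mu (EFin \o B) t2)%E by exact: integral_ge0.
have FB u1 : (0 <= fubini_F mu (EFin \o B) u1)%E by exact: integral_ge0.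
have FF u1 : (0 <= fubini_F mu (EFin \o F) u1)%E by exact: integral_ge0.
have K10 : (0 <= K1)%R := K0 lam1; have K20 : (0 <= K2)%R := K0 lam2.
have step1 : (K1%:E * \int[mu]_t2 fubini_G mu (EFin \o A) t2 <=
    \int[mu]_t2 fubini_G mu (EFin \o B) t2)%E.
  apply: (ge0_integral_scale_le K10 mFA mFB GA GB).
  apply: filterS2 (ae_integrable2 ip) (ae_integrable2 iq) => t2 pt qt.
  exact: (complex_plancherel_le lam10 (p := sec p t2) (q := sec q t2) pt qt).
have step2 : (K2%:E * \int[mu]_u1 fubini_F mu (EFin \o B) u1 <=
    \int[mu]_u1 fubini_F mu (EFin \o F) u1)%E.
  apply: (ge0_integral_scale_le K20 mFB' mFF FB FF).
  apply: aeW => u1.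
  have ci := integrable_c1 lam1 u1 ip iq; have si := integrable_s1 lam1 u1 ip iq.
  apply: le_trans (complex_plancherel_le lam20 ci si) _.
  rewrite le_eqVlt; apply/orP; left; apply/eqP.
  apply: eq_integral => u2 _; congr EFin; rewrite /F.
  by rewrite (cfourier2E _ _ _ ip iq) (sfourier2E _ _ _ ip iq).
rewrite EFinM -muleA [leRHS]IF.
apply: le_trans step2; apply: lee_wpmul2l; first by rewrite lee_fin.
by rewrite [X in (_ * X)%E]IA [leRHS]IB.
Qed.

End plancherel2.

(** * Translations and uncertainty *)

Section translation2.
Context {R : realType}.
Local Notation mu2 := (@lebesgue_measure R \x @lebesgue_measure R)%E.
Local Notation T := (measurableTypeR R).
Local Notation itg2 f := (mu2.-integrable setT (EFin \o f)).
Implicit Types (p q : T * T -> R) (u v t : R * R).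

Lemma integrable2_translation p v : itg2 p -> itg2 (fun t => p (t + v)).
Proof.
move=> pi; exact: (integrable_preserving (measurable_translation2 v)
  (@mu2_translation R v) (integrable_EFin_measurable pi) pi).
Qed.

Lemma Rintegral2_translation p v : measurable_fun [set: T * T] p ->
  \int[mu2]_t p (t + v) = \int[mu2]_t p t.
Proof.
move=> mp; exact: (Rintegral_preserving (measurable_translation2 v)
  (@mu2_translation R v) mp).
Qed.

Lemma ge0_integral2_translation p v : measurable_fun [set: T * T] p ->
  (forall t, 0 <= p t) ->
  (\int[mu2]_t (p (t + v))%:E = \int[mu2]_t (p t)%:E)%E.
Proof.
move=> mp p0; apply: (@ge0_integral_preserving _ _ _ _ _ (measurable_translation2 v)
  (@mu2_translation R v) (fun t => (p t)%:E)).
- exact/measurable_EFinP.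
- by move=> t; rewrite lee_fin.
Qed.

Variables lam1 lam2 : R.
Local Notation phase2 := (phase2 lam1 lam2).
Local Notation cfourier2 := (cfourier2 lam1 lam2).
Local Notation sfourier2 := (sfourier2 lam1 lam2).

Lemma phase2D u t v : phase2 u (t + v) = phase2 u t + phase2 u v.
Proof. by rewrite /phase2 /=; ring. Qed.

Lemma integrable_cfourier2 p q u : itg2 p -> itg2 q ->
  itg2 (fun t => p t * cos (phase2 u t) + q t * sin (phase2 u t)).
Proof.
move=> pi qi; apply: integrable_EFinD.
- exact: (integrable2_cos pi (measurable_phase2 _ _ u)).
- exact: (integrable2_sin qi (measurable_phase2 _ _ u)).
Qed.

Lemma integrable_sfourier2 p q u : itg2 p -> itg2 q ->
  itg2 (fun t => q t * cos (phase2 u t) - p t * sin (phase2 u t)).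
Proof.
move=> pi qi; apply: integrable_EFinB.
- exact: (integrable2_cos qi (measurable_phase2 _ _ u)).
- exact: (integrable2_sin pi (measurable_phase2 _ _ u)).
Qed.

(** A translation by v multiplies the transform by exp (i phase2 u v). *)
Lemma cfourier2_translation p q u v : itg2 p -> itg2 q ->
  cfourier2 (fun t => p (t + v)) (fun t => q (t + v)) u =
  cos (phase2 u v) * cfourier2 p q u - sin (phase2 u v) * sfourier2 p q u.
Proof.
move=> pi qi.
have ci := integrable_cfourier2 u pi qi; have si := integrable_sfourier2 u pi qi.
rewrite /cfourier2 /sfourier2 -(RintegralZl _ measurableT ci) -(RintegralZl _ measurableT si).
rewrite -(RintegralB measurableT (integrable_EFinZ _ ci) (integrable_EFinZ _ si)).
have gi := integrable_EFinB (integrable_EFinZ (cos (phase2 u v)) ci)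
  (integrable_EFinZ (sin (phase2 u v)) si).
rewrite -[RHS](Rintegral2_translation v (integrable_EFin_measurable gi)).
apply: eq_Rintegral => t _; rewrite phase2D (cosD (phase2 u t)) (sinD (phase2 u t)).
have := cos2Dsin2 (phase2 u v).
set a := cos (phase2 u v); set b := sin (phase2 u v).
set c := cos (phase2 u t); set d := sin (phase2 u t).
move=> ab.
transitivity ((a ^+ 2 + b ^+ 2) * (p (t + v) * c + q (t + v) * d)); last by ring.
by rewrite ab mul1r.
Qed.

Lemma sfourier2_translation p q u v : itg2 p -> itg2 q ->
  sfourier2 (fun t => p (t + v)) (fun t => q (t + v)) u =
  cos (phase2 u v) * sfourier2 p q u + sin (phase2 u v) * cfourier2 p q u.
Proof.
move=> pi qi.
have ci := integrable_cfourier2 u pi qi; have si := integrable_sfourier2 u pi qi.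
rewrite /cfourier2 /sfourier2 -(RintegralZl _ measurableT ci) -(RintegralZl _ measurableT si).
rewrite -(RintegralD measurableT (integrable_EFinZ _ si) (integrable_EFinZ _ ci)).
have gi := integrable_EFinD (integrable_EFinZ (cos (phase2 u v)) si)
  (integrable_EFinZ (sin (phase2 u v)) ci).
rewrite -[RHS](Rintegral2_translation v (integrable_EFin_measurable gi)).
apply: eq_Rintegral => t _; rewrite phase2D (cosD (phase2 u t)) (sinD (phase2 u t)).
have := cos2Dsin2 (phase2 u v).
set a := cos (phase2 u v); set b := sin (phase2 u v).
set c := cos (phase2 u t); set d := sin (phase2 u t).
move=> ab.
transitivity ((a ^+ 2 + b ^+ 2) * (q (t + v) * c - p (t + v) * d)); last by ring.
by rewrite ab mul1r.
Qed.

Lemma cfourier2B p1 p2 q1 q2 u : itg2 p1 -> itg2 p2 -> itg2 q1 -> itg2 q2 ->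
  cfourier2 (fun t => p1 t - p2 t) (fun t => q1 t - q2 t) u =
  cfourier2 p1 q1 u - cfourier2 p2 q2 u.
Proof.
move=> p1i p2i q1i q2i; rewrite /cfourier2.
have i1 := integrable_cfourier2 u p1i q1i; have i2 := integrable_cfourier2 u p2i q2i.
rewrite -(RintegralB measurableT i1 i2).
by apply: eq_Rintegral => t _; ring.
Qed.

Lemma sfourier2B p1 p2 q1 q2 u : itg2 p1 -> itg2 p2 -> itg2 q1 -> itg2 q2 ->
  sfourier2 (fun t => p1 t - p2 t) (fun t => q1 t - q2 t) u =
  sfourier2 p1 q1 u - sfourier2 p2 q2 u.
Proof.
move=> p1i p2i q1i q2i; rewrite /sfourier2.
have i1 := integrable_sfourier2 u p1i q1i; have i2 := integrable_sfourier2 u p2i q2i.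
rewrite -(RintegralB measurableT i1 i2).
by apply: eq_Rintegral => t _; ring.
Qed.

Hypotheses (lam10 : lam1 != 0) (lam20 : lam2 != 0).

(** The weight is |exp (i a) - 1| ^ 2 = 2 - 2 cos a at a = phase2 u v. *)
Lemma displacement_le p q v : itg2 p -> itg2 q ->
  ((2 * pi / `|lam2| * (2 * pi / `|lam1|))%:E *
     \int[mu2]_t ((p (t + v) - p t) ^+ 2 + (q (t + v) - q t) ^+ 2)%:E <=
   \int[mu2]_u ((2 - 2 * cos (phase2 u v)) *
      (cfourier2 p q u ^+ 2 + sfourier2 p q u ^+ 2))%:E)%E.
Proof.
move=> ip iq; have ip' := integrable2_translation v ip.
have iq' := integrable2_translation v iq.
apply: le_trans (plancherel2_le lam10 lam20 (integrable_EFinB ip' ip)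
  (integrable_EFinB iq' iq)) _.
rewrite le_eqVlt; apply/orP; left; apply/eqP; apply: eq_integral => u _; congr EFin.
rewrite (cfourier2B u ip' ip iq' iq) (sfourier2B u ip' ip iq' iq).
rewrite (cfourier2_translation u v ip iq) (sfourier2_translation u v ip iq).
have := cos2Dsin2 (phase2 u v).
set a := cos (phase2 u v); set b := sin (phase2 u v).
set C := cfourier2 p q u; set S := sfourier2 p q u => ab.
transitivity ((a ^+ 2 + b ^+ 2 + 1 - 2 * a) * (C ^+ 2 + S ^+ 2)); first by ring.
by rewrite ab; ring.
Qed.

End translation2.

Section abstract_uncertainty.
Context {R : realType}.
Local Notation mu2 := (@lebesgue_measure R \x @lebesgue_measure R)%E.
Local Notation T := (measurableTypeR R).
Local Notation itg2 f := (mu2.-integrable setT (EFin \o f)).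

(** For E > 0, the choice y = N / E turns the bound into
    N <= N / 2 + 2 D E / N.  For E = 0, a large y shows that N = 0. *)
Lemma AMGM_discriminant (N D E : R) : 0 <= N -> 0 <= D -> 0 <= E ->
  (forall y, 0 < y -> N <= y / 2 * E + 2 * D / y) -> N ^+ 2 <= 4 * D * E.
Proof.
move=> N0 D0 E0 H.
have [->|Nn0] := eqVneq N 0; first by rewrite expr0n/= !mulr_ge0.
have Np : 0 < N by rewrite lt_neqAle eq_sym Nn0.
have [E00|En0] := eqVneq E 0.
  (* at this y, the hypothesis N <= 2 D / y would give 4 D + N <= 2 D *)
  have y0 : 0 < 4 * D / N + 1 by rewrite ltr_wpDl// divr_ge0// mulr_ge0.
  have := H _ y0; rewrite E00 mulr0 add0r ler_pdivlMr//.
  rewrite mulrDr mulr1 [N * (_ / _)]mulrC divfK// => ?; exfalso; lra.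
have Ep : 0 < E by rewrite lt_neqAle eq_sym En0.
have y0 : 0 < N / E by rewrite divr_gt0.
have := H _ y0.
rewrite (_ : N / E / 2 * E = N / 2); last by field.
rewrite (_ : 2 * D / (N / E) = 2 * D * E / N); last by field; rewrite ?En0 ?Nn0.
move=> H1; have : N / 2 <= 2 * D * E / N by lra.
by rewrite ler_pdivlMr// expr2; lra.
Qed.

Variables (P Q x : T * T -> R) (v : R -> R * R).
Hypotheses (mP : measurable_fun [set: T * T] P) (mQ : measurable_fun [set: T * T] Q).
Hypothesis mx : measurable_fun [set: T * T] x.
Hypothesis xv : forall t s, x (t + v s) = x t + s.
Let w t := P t ^+ 2 + Q t ^+ 2.

Let w0 t : 0 <= w t. Proof. by rewrite addr_ge0 ?sqr_ge0. Qed.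

Let mw : measurable_fun [set: T * T] w.
Proof. by apply: measurable_funD; exact: measurable_funX. Qed.

Variables (E : R).
Hypotheses (iw : itg2 w) (ix2w : itg2 (fun t => x t ^+ 2 * w t)).
Hypothesis E0 : 0 <= E.
Hypothesis disp : forall s, 0 < s ->
  (\int[mu2]_t ((P (t + v s) - P t) ^+ 2 + (Q (t + v s) - Q t) ^+ 2)%:E
    <= (s ^+ 2 * E)%:E)%E.

(** A translation by v s lowers the first moment of w by s N, so s N is the
    integral of x (w - w (. + v s)).  With c = y / s, the pointwise bound [pt]
    below estimates it by the displacement, which is at most s ^ 2 E, and by the
    second moments of w and of its translate.  Divided by s, this reads
    N <= (y / 2) E + 2 D / y + O(s). *)
Lemma translation_uncertainty :
  (\int[mu2]_t w t) ^+ 2 <= 4 * (\int[mu2]_t (x t ^+ 2 * w t)) * E.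
Proof.
set N := \int[mu2]_t w t; set D := \int[mu2]_t (x t ^+ 2 * w t).
have mx2 : measurable_fun [set: T * T] (fun t => x t ^+ 2) by exact: measurable_funX.
have ixw : itg2 (fun t => x t * w t).
  apply: le_integrable_real (integrable_EFinD iw ix2w).
    exact: measurable_funM.
  move=> t; rewrite normrM (ger0_norm (w0 t)) -[X in X + _]mul1r -mulrDl.
  rewrite ler_wpM2r// -(real_normK (num_real (x t))).
  have := sqr_ge0 (`|x t| - 1); have := normr_ge0 (x t); nra.
set X := \int[mu2]_t (x t * w t).
apply: AMGM_discriminant => //.
- by apply: Rintegral_ge0 => t _; exact: w0.
- by apply: Rintegral_ge0 => t _; apply: mulr_ge0; [exact: sqr_ge0|exact: w0].
move=> y y0.
have key s : 0 < s -> N <= y / 2 * E + (2 * D - 2 * s * X + s ^+ 2 * N) / y.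
  move=> s0.
  pose d t := (P (t + v s) - P t) ^+ 2 + (Q (t + v s) - Q t) ^+ 2.
  have d0 t : 0 <= d t by rewrite addr_ge0 ?sqr_ge0.
  have mshift f : measurable_fun [set: T * T] f ->
      measurable_fun [set: T * T] (fun t : T * T => f (t + v s) : R).
    by move=> mf; exact: (measurableT_comp mf (measurable_translation2 (v s))).
  have md : measurable_fun [set: T * T] d.
    by apply: measurable_funD; apply: measurable_funX; apply: measurable_funB => //;
      exact: mshift.
  have di : itg2 d.
    by apply: integrable_lt => //; apply: le_lt_trans (disp s0) _; exact: ltry.
  have dle : \int[mu2]_t d t <= s ^+ 2 * E.
    by rewrite -lee_fin -(EFin_Rintegral di); exact: disp.
  have isw := integrable_EFinZ s iw.
  have ixsw := integrable_EFinB ixw isw.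
  have i1 : itg2 (fun t => x t * w (t + v s)).
    have := integrable2_translation (v s) ixsw.
    congr (_.-integrable _ _); apply/funext => t /=; congr EFin.
    by rewrite xv; ring.
  have I1 : \int[mu2]_t (x t * w (t + v s)) = X - s * N.
    rewrite /X /N -(RintegralZl s measurableT iw) -(RintegralB measurableT ixw isw).
    rewrite -[RHS](Rintegral2_translation (v s) (integrable_EFin_measurable ixsw)).
    by apply: eq_Rintegral => t _; rewrite xv; ring.
  have i2sx := integrable_EFinZ (2 * s) ixw.
  have is2w := integrable_EFinZ (s ^+ 2) iw.
  have i2' := integrable_EFinD (integrable_EFinB ix2w i2sx) is2w.
  have i2 : itg2 (fun t => x t ^+ 2 * w (t + v s)).
    have := integrable2_translation (v s) i2'.
    congr (_.-integrable _ _); apply/funext => t /=; congr EFin.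
    by rewrite xv; ring.
  have I2 : \int[mu2]_t (x t ^+ 2 * w (t + v s)) = D - 2 * s * X + s ^+ 2 * N.
    rewrite /D /X /N -(RintegralZl _ measurableT ixw) -(RintegralZl _ measurableT iw).
    rewrite -(RintegralB measurableT ix2w i2sx).
    rewrite -(RintegralD measurableT (integrable_EFinB ix2w i2sx) is2w).
    rewrite -[RHS](Rintegral2_translation (v s) (integrable_EFin_measurable i2')).
    by apply: eq_Rintegral => t _; rewrite xv; ring.
  pose c := y / s.
  have c0 : 0 < c by rewrite divr_gt0.
  have main : \int[mu2]_t (x t * w t - x t * w (t + v s)) <=
     \int[mu2]_t (c / 2 * d t + c^-1 * (x t ^+ 2 * w t + x t ^+ 2 * w (t + v s))).
    have ir := integrable_EFinD (integrable_EFinZ (c / 2) di)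
      (integrable_EFinZ c^-1 (integrable_EFinD ix2w i2)).
    apply: (le_Rintegral measurableT (integrable_EFinB ixw i1) ir) => t _.
    rewrite /w /d.
    (* completing the square gives z (a - b) (a + b) <= c / 2 (a - b) ^ 2 + z ^ 2 (a + b) ^ 2 / (2 c) *)
    have pt (a b z : R) : z * (a ^+ 2 - b ^+ 2) <=
        c / 2 * (b - a) ^+ 2 + c^-1 * (z ^+ 2 * a ^+ 2 + z ^+ 2 * b ^+ 2).
      rewrite -(ler_pM2l c0) [leRHS]mulrDr [c * (c^-1 * _)]mulrA divff ?gt_eqF// mul1r.
      have := sqr_ge0 (c * (b - a) + z * (a + b)).
      have := mulr_ge0 (sqr_ge0 z) (sqr_ge0 (a - b)).
      nra.
    have := pt (P t) (P (t + v s)) (x t); have := pt (Q t) (Q (t + v s)) (x t).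
    lra.
  move: main.
  rewrite (RintegralB measurableT ixw i1) I1.
  rewrite (RintegralD measurableT (integrable_EFinZ (c / 2) di)
      (integrable_EFinZ c^-1 (integrable_EFinD ix2w i2))).
  rewrite (RintegralZl _ measurableT di) (RintegralZl _ measurableT (integrable_EFinD ix2w i2)).
  rewrite (RintegralD measurableT ix2w i2) I2 -/X -/D.
  rewrite opprB addrCA subrr addr0 => main.
  have {}main : s * N <= c / 2 * (s ^+ 2 * E) + c^-1 * (D + (D - 2 * s * X + s ^+ 2 * N)).
    apply: le_trans main _; rewrite lerD2r ler_wpM2l// divr_ge0// ltW//.
  rewrite -(ler_pM2l s0); apply: le_trans main _.
  rewrite le_eqVlt; apply/orP; left; apply/eqP; rewrite /c; field.
  by rewrite !gt_eqF.
apply/ler_addgt0Pr => eta eta0.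
(* bounds the coefficient of s in the error term, for s <= 1 *)
pose B := (2 * `|X| + N) / y + 1.
have N0 : 0 <= N by apply: Rintegral_ge0 => t _; exact: w0.
have B0 : 0 < B by rewrite ltr_wpDl// divr_ge0 ?(ltW y0)// addr_ge0// mulr_ge0.
pose s := Num.min 1 (eta / B).
have s0 : 0 < s by rewrite lt_min ltr01 divr_gt0.
apply: le_trans (key s s0) _.
rewrite -[leRHS]addrA lerD2l.
have s1 : s <= 1 by rewrite ge_min lexx.
have sB : s * B <= eta by rewrite -ler_pdivlMr// ge_min lexx orbT.
have : (- 2 * s * X + s ^+ 2 * N) / y <= s * ((2 * `|X| + N) / y).
  rewrite mulrA ler_wpM2r ?invr_ge0 ?(ltW y0)//.
  have sX : s * (- X) <= s * `|X|.
    by rewrite ler_wpM2l ?(ltW s0)// -normrN ler_norm.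
  have sN : s * (s * N) <= s * N.
    by rewrite ler_wpM2l ?(ltW s0)// ler_piMl.
  lra.
have -> : (2 * D - 2 * s * X + s ^+ 2 * N) / y =
    2 * D / y + (- 2 * s * X + s ^+ 2 * N) / y by ring.
have : s * ((2 * `|X| + N) / y) <= s * B by rewrite ler_wpM2l ?(ltW s0)// /B lerDl.
lra.
Qed.

End abstract_uncertainty.

(** * Passage to the limit *)

Section chord.
Context {R : realType}.

Lemma sin_le_id (x : R) : 0 <= x -> sin x <= x.
Proof.
rewrite le_eqVlt => /predU1P[<-|x0]; first by rewrite sin0.
have [|c _] := @MVT R (fun y => y - sin y) (fun y => 1 - cos y) 0 x x0 _ _.
- apply: continuous_subspaceT => y; apply: cvgB; first exact: cvg_id.
  exact: continuous_sin.
- rewrite sin0 !subr0 => H.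
  by rewrite -subr_ge0 H mulr_ge0 ?(ltW x0)// subr_ge0 cos_le1.
Qed.

(** A chord of the unit circle is at most as long as its arc:
    |exp (i x) - 1| ^ 2 = 2 - 2 cos x. *)
Lemma chord_le_arc (x : R) : 2 - 2 * cos x <= x ^+ 2.
Proof.
wlog x0 : x / 0 <= x.
  move=> H; have [/H//|/ltW x0] := leP 0 x.
  by rewrite -cosN -sqrrN; apply: H; rewrite oppr_ge0.
move: x0; rewrite le_eqVlt => /predU1P[<-|x0]; first by rewrite cos0 expr0n/=; lra.
have [||c] := @MVT R (fun y => y ^+ 2 + 2 * cos y) (fun y => 2 * (y - sin y)) 0 x x0 _ _.
- move=> y _; apply: is_derive_eq; rewrite /GRing.scale/=; ring.
- apply: continuous_subspaceT => y; apply: cvgD; first by rewrite expr2; apply: cvgM; exact: cvg_id.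
  by apply: cvgM; [exact: cvg_cst|exact: continuous_cos].
- rewrite in_itv/= => /andP[c0 _]; rewrite cos0 expr0n/= add0r mulr1 subr0 => H.
  have : 0 <= 2 * (c - sin c) * x.
    by rewrite mulr_ge0 ?(ltW x0)// mulr_ge0// subr_ge0 sin_le_id// ltW.
  lra.
Qed.

End chord.

Section quadratic_limit.
Context {R : realType} d (X : measurableType d) d' (Y : measurableType d').
Variables (m : {measure set X -> \bar R}) (n : {measure set Y -> \bar R}).

(** If a and w are the limits in the L2 sense of ak and wk, with errors bk and
    ok, then an inequality between the integrals of ak and wk passes to the
    limit.  The errors are controlled pointwise by
    |z + z'| ^ 2 <= (1 + eta) |z| ^ 2 + (1 + 1 / eta) |z'| ^ 2, which replaces
    the triangle inequality for the norm and needs only integrals of squares;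
    eta is fixed first, and then k. *)
Lemma quadratic_limit (a : X -> R) (w : Y -> R) (ak bk : nat -> X -> R)
  (wk ok : nat -> Y -> R) :
  measurable_fun setT a -> (forall k, measurable_fun setT (ak k)) ->
  (forall k, measurable_fun setT (bk k)) ->
  measurable_fun setT w -> (forall k, measurable_fun setT (wk k)) ->
  (forall k, measurable_fun setT (ok k)) ->
  (forall x, 0 <= a x) -> (forall k x, 0 <= ak k x) -> (forall k x, 0 <= bk k x) ->
  (forall x, 0 <= w x) -> (forall k x, 0 <= wk k x) -> (forall k x, 0 <= ok k x) ->
  (forall eta k x, 0 < eta -> a x <= (1 + eta) * ak k x + (1 + eta^-1) * bk k x) ->
  (forall eta k y, 0 < eta -> wk k y <= (1 + eta) * w y + (1 + eta^-1) * ok k y) ->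
  (forall k, (\int[m]_x (ak k x)%:E <= \int[n]_y (wk k y)%:E)%E) ->
  (forall e, 0 < e -> \forall k \near \oo, (\int[m]_x (bk k x)%:E <= e%:E)%E) ->
  (forall e, 0 < e -> \forall k \near \oo, (\int[n]_y (ok k y)%:E <= e%:E)%E) ->
  (\int[m]_x (a x)%:E <= \int[n]_y (w y)%:E)%E.
Proof.
move=> ma mak mbk mw mwk mok a0 ak0 bk0 w0 wk0 ok0 aE wE le bcv ocv.
have W0 := integral_EFin_ge0 n w0.
have [->|Wfin] := eqVneq (\int[n]_y (w y)%:E)%E +oo%E; first exact: leey.
have WE : (\int[n]_y (w y)%:E = (fine (\int[n]_y (w y)%:E))%:E)%E.
  by rewrite fineK// ge0_fin_numE// lt_neqAle Wfin leey.
rewrite WE; set W := fine _ in WE *.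
have W0' : 0 <= W by rewrite /W fine_ge0.
apply/lee_addgt0Pr => tau tau0.
(* small enough that (1 + eta) ^ 2 W <= W + tau / 2 *)
pose eta : R := Num.min 1 (tau / (6 * (W + 1))).
have W1 : 0 < 6 * (W + 1) by rewrite mulr_gt0// ltr_wpDl.
have eta0 : 0 < eta by rewrite lt_min ltr01 divr_gt0.
have eta1 : eta <= 1 by rewrite ge_min lexx.
have etaW : eta * (6 * (W + 1)) <= tau.
  by rewrite -ler_pdivlMr// ge_min lexx orbT.
pose c := 1 + eta^-1.
have c0 : 0 < c by rewrite addr_gt0// invr_gt0.
(* the error terms enter with the factor c, large when eta is small *)
pose e := tau / (6 * c).
have e0 : 0 < e by rewrite divr_gt0// mulr_gt0.
have ec : c * e = tau / 6 by rewrite /e; field; rewrite gt_eqF.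
have := filterI (bcv e e0) (ocv e e0).
move=> [k _ /(_ k (leqnn k))[/= bke oke]].
have c1 : 0 < 1 + eta by rewrite addr_gt0.
have iw : (\int[n]_y (wk k y)%:E <= ((1 + eta) * W + c * e)%:E)%E.
  apply: (@le_trans _ _ (\int[n]_y ((1 + eta) * w y + c * ok k y)%:E)%E).
    apply: le_integral_EFin => //.
    - by apply: measurable_funD; exact: measurable_funM.
    - by move=> y; exact: wE.
  have := integral_EFinD n (f := fun y => (1 + eta) * w y) (g := fun y => c * ok k y).
  move=> ->; first last.
  - by move=> y; rewrite mulr_ge0 ?(ltW c0).
  - by move=> y; rewrite mulr_ge0 ?(ltW c1).
  - exact: measurable_funM.
  - exact: measurable_funM.
  rewrite (integral_EFinZ n mw w0 (ltW c1)) (integral_EFinZ n (mok k) (ok0 k) (ltW c0)).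
  rewrite [leRHS]EFinD WE -EFinM; apply: leeD => //.
  by rewrite EFinM; apply: lee_wpmul2l => //; rewrite lee_fin ltW.
apply: (@le_trans _ _ (\int[m]_x ((1 + eta) * ak k x + c * bk k x)%:E)%E).
  apply: le_integral_EFin => //.
  - by apply: measurable_funD; exact: measurable_funM.
  - by move=> x; exact: aE.
have := integral_EFinD m (f := fun x => (1 + eta) * ak k x) (g := fun x => c * bk k x).
move=> ->; first last.
- by move=> x; rewrite mulr_ge0 ?(ltW c0).
- by move=> x; rewrite mulr_ge0 ?(ltW c1).
- exact: measurable_funM.
- exact: measurable_funM.
rewrite (integral_EFinZ m (mak k) (ak0 k) (ltW c1)) (integral_EFinZ m (mbk k) (bk0 k) (ltW c0)).
apply: (@le_trans _ _ ((1 + eta)%:E * ((1 + eta) * W + c * e)%:E + c%:E * e%:E)%E).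
  apply: leeD; apply: lee_wpmul2l; rewrite ?lee_fin ?(ltW c0) ?(ltW c1)//.
  exact: le_trans (le k) iw.
rewrite -!EFinM -!EFinD lee_fin ec.
have : eta * W <= tau / 6 by lra.
have : eta * (eta * W) <= eta * W by rewrite ler_piMl// mulr_ge0// ltW.
have : eta * tau <= tau by rewrite ler_piMl// ltW.
rewrite (_ : (1 + eta) * ((1 + eta) * W + tau / 6) =
   W + 2 * (eta * W) + eta * (eta * W) + tau / 6 + eta * tau / 6); last by ring.
lra.
Qed.

End quadratic_limit.

(** * The transform as a Fourier transform *)

Section complex_interface.
Context {R : realType}.
Local Notation mu2 := (@lebesgue_measure R \x @lebesgue_measure R)%E.
Local Notation T := (measurableTypeR R).
Local Notation itg2 f := (mu2.-integrable setT (EFin \o f)).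
Local Notation Re := complex.Re.
Local Notation Im := complex.Im.
Implicit Types (z w : R[i]) (F f g : R * R -> R[i]).

(** The square modulus, a polynomial in the real and imaginary parts. *)
Definition sqn z : R := Re z ^+ 2 + Im z ^+ 2.

Lemma sqn_ge0 z : 0 <= sqn z.
Proof. by rewrite addr_ge0 ?sqr_ge0. Qed.

Lemma cabs_sqr z : cabs z ^+ 2 = sqn z.
Proof.
by case: z => a b; rewrite /cabs /sqn /= sqr_sqrtr// addr_ge0 ?sqr_ge0.
Qed.

Lemma cabs_ge0 z : 0 <= cabs z.
Proof. by case: z => a b; rewrite /cabs /= sqrtr_ge0. Qed.

Lemma sqnM z w : sqn (z * w) = sqn z * sqn w.
Proof. by case: z w => [a b] [c d]; rewrite /sqn /=; ring. Qed.

(** Multiplied by eta, the difference of the two sides is the square modulus of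
    eta w - (z - w). *)
Lemma sqn_perturb (eta : R) z w : 0 < eta ->
  sqn z <= (1 + eta) * sqn w + (1 + eta^-1) * sqn (z - w).
Proof.
case: z w => [a b] [c d] eta0; rewrite /sqn /=.
have sq (x y : R) : x ^+ 2 <= (1 + eta) * y ^+ 2 + (1 + eta^-1) * (x - y) ^+ 2.
  rewrite -(ler_pM2l eta0) -subr_ge0.
  rewrite (_ : _ - _ = (eta * y - (x - y)) ^+ 2); first exact: sqr_ge0.
  by field; rewrite gt_eqF.
have := sq a c; have := sq b d; lra.
Qed.

Lemma sqnB_le z w : sqn (z - w) <= 2 * sqn z + 2 * sqn w.
Proof.
case: z w => [a b] [c d]; rewrite /sqn /=.
have := sqr_ge0 (a + c); have := sqr_ge0 (b + d); lra.
Qed.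

Lemma cmeasurable_Re F : cmeasurable F -> measurable_fun [set: T * T] (fun t => Re (F t)).
Proof. by case. Qed.

Lemma cmeasurable_Im F : cmeasurable F -> measurable_fun [set: T * T] (fun t => Im (F t)).
Proof. by case. Qed.

Lemma measurable_sqn F : cmeasurable F -> measurable_fun [set: T * T] (fun t => sqn (F t)).
Proof.
move=> mF; apply: measurable_funD; apply: measurable_funX.
  exact: cmeasurable_Re.
exact: cmeasurable_Im.
Qed.

Lemma cmeasurableB F g : cmeasurable F -> cmeasurable g ->
  cmeasurable (fun t => F t - g t).
Proof.
move=> mF mg; split.
- have : measurable_fun [set: T * T] (fun t => Re (F t) - Re (g t)).
    by apply: measurable_funB; exact: cmeasurable_Re.
  by congr measurable_fun; apply/funext => t; case: (F t) (g t) => [? ?] [].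
- have : measurable_fun [set: T * T] (fun t => Im (F t) - Im (g t)).
    by apply: measurable_funB; exact: cmeasurable_Im.
  by congr measurable_fun; apply/funext => t; case: (F t) (g t) => [? ?] [].
Qed.

Lemma Lpnorm2E F : (Lpnorm 2 F * Lpnorm 2 F = \int[mu2]_t (sqn (F t))%:E)%E.
Proof.
have n2 : 2 != 0 :> R by rewrite pnatr_eq0.
have := poweR_Lnorm mu2 (fun t => (cabs (F t))%:E) n2.
rewrite -/(Lpnorm 2 F).
have L0 : (0 <= Lpnorm 2 F)%E by exact: Lnorm_ge0.
rewrite (_ : (Lpnorm 2 F `^ 2 = Lpnorm 2 F * Lpnorm 2 F)%E); last first.
  move: L0; case: (Lpnorm 2 F) => [r r0| |//].
    by rewrite poweR_EFin powR_mulrn// expr2 EFinM.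
  by move=> _; rewrite poweRyr// mulyy.
move=> ->; apply: eq_integral => t _ /=.
by rewrite powR_mulrn ?normr_ge0// real_normK ?num_real// cabs_sqr.
Qed.

Lemma in_L2P F : in_Lp 2 F -> (\int[mu2]_t (sqn (F t))%:E < +oo)%E.
Proof.
move=> [mF]; have L0 : (0 <= Lpnorm 2 F)%E by exact: Lnorm_ge0.
rewrite -Lpnorm2E => Loo.
by rewrite lte_mul_pinfty// ge0_fin_numE.
Qed.

Lemma Lpnorm2_cvg0 (G : nat -> R * R -> R[i]) (e : R) :
  (fun n => Lpnorm 2 (G n)) @ \oo --> (0 : \bar R) -> 0 < e ->
  \forall n \near \oo, (\int[mu2]_t (sqn (G n t))%:E <= e%:E)%E.
Proof.
move=> G0 e0; pose d : R := Num.min 1 e.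
have d0 : 0 < d by rewrite lt_min ltr01.
apply: filterS (cvge0_lt G0 d0) => n.
rewrite -Lpnorm2E; have : (0 <= Lpnorm 2 (G n))%E by exact: Lnorm_ge0.
case: (Lpnorm 2 (G n)) => [r|//|//]; rewrite !lee_fin !lte_fin => r0 rd.
have [d1 de] : d <= 1 /\ d <= e by rewrite !ge_min !lexx orbT.
apply: (@le_trans _ _ (1 * r)); last by rewrite mul1r (le_trans (ltW rd)).
by rewrite ler_wpM2r// (le_trans (ltW rd)).
Qed.

Lemma norm_Re_le z : `|Re z| <= cabs z.
Proof.
case: z => a b; rewrite /cabs /= -sqrtr_sqr ler_wsqrtr// lerDl sqr_ge0//.
Qed.

Lemma norm_Im_le z : `|Im z| <= cabs z.
Proof.
case: z => a b; rewrite /cabs /= -sqrtr_sqr ler_wsqrtr// lerDr sqr_ge0//.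
Qed.

Lemma measurable_cabs F : cmeasurable F ->
  measurable_fun [set: T * T] (fun t => cabs (F t)).
Proof.
move=> mF; have -> : (fun t => cabs (F t)) = (fun t => Num.sqrt (sqn (F t))).
  by apply/funext => t; rewrite -cabs_sqr sqrtr_sqr ger0_norm ?cabs_ge0.
apply: (measurableT_comp (continuous_measurable (@sqrt_continuous R))).
exact: measurable_sqn.
Qed.

Lemma in_L1P F : in_Lp 1 F -> itg2 (fun t => Re (F t)) /\ itg2 (fun t => Im (F t)).
Proof.
move=> [mF]; rewrite /Lpnorm Lnorm1 => F1.
have mc := measurable_cabs mF.
have ci : itg2 (fun t => cabs (F t)).
  by apply/integrableP; split; first exact/measurable_EFinP.
split.
- apply: le_integrable_real ci; first exact: cmeasurable_Re.
  by move=> t; exact: norm_Re_le.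
- apply: le_integrable_real ci; first exact: cmeasurable_Im.
  by move=> t; exact: norm_Im_le.
Qed.

Definition cis (x : R) : R[i] := (cos x +i* sin x)%C.

Lemma cisD x y : cis (x + y) = cis x * cis y.
Proof.
by apply/eqP; rewrite eq_complex /= cosD sinD; apply/andP; split; apply/eqP; ring.
Qed.

Lemma sqn_cis x : sqn (cis x) = 1.
Proof. exact: cos2Dsin2. Qed.

Lemma cexp_imaginary (b X : R) : b != 0 ->
  cexp ('i%C / real_complex R (2 * b) * real_complex R X) = cis (X / (2 * b)).
Proof.
move=> b0.
have -> : 'i%C / real_complex R (2 * b) * real_complex R X =
    (0 +i* (X / (2 * b)))%C.
  rewrite -fmorphV /=; apply/eqP; rewrite eq_complex /=; apply/andP; split; apply/eqP; ring.
by rewrite /cexp /= expR0 mul1r.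
Qed.

Lemma cintegralZ z F : itg2 (fun t => Re (F t)) -> itg2 (fun t => Im (F t)) ->
  cintegral (fun t => z * F t) = z * cintegral F.
Proof.
case: z => a b rF iF; apply/eqP; rewrite eq_complex /=; apply/andP; split; apply/eqP.
- rewrite -(RintegralZl a measurableT rF) -(RintegralZl b measurableT iF).
  rewrite -(RintegralB measurableT (integrable_EFinZ a rF) (integrable_EFinZ b iF)).
  by apply: eq_Rintegral => t _; case: (F t).
- rewrite -(RintegralZl a measurableT iF) -(RintegralZl b measurableT rF).
  rewrite -(RintegralD measurableT (integrable_EFinZ a iF) (integrable_EFinZ b rF)).
  by apply: eq_Rintegral => t _; case: (F t).
Qed.

(** The exponent of the kernel is i times
    [input_phase M t] + [output_phase M u] - u t / b. *)
Definition input_phase (M : olct_param R) (t : R) : R :=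
  (pa M * t ^+ 2 + 2 * ptau M * t) / (2 * pb M).

Definition output_phase (M : olct_param R) (u : R) : R :=
  (pd M * u ^+ 2 + pd M * ptau M ^+ 2 - 2 * u * (pd M * ptau M - pb M * peta M))
    / (2 * pb M).

Definition kernel_const (M : olct_param R) : R[i] :=
  sqrtc (1 / (real_complex R (2 * pi) * 'i%C * real_complex R (pb M))).

Lemma olct_kernelE (M : olct_param R) u t : pb M != 0 ->
  olct_kernel M u t = kernel_const M *
    cis (input_phase M t + output_phase M u - (pb M)^-1 * u * t).
Proof.
case: M => a b c d tau eta /= b0; rewrite cexp_imaginary// /kernel_const /=.
congr (_ * cis _); rewrite /input_phase /output_phase /=.
by field.
Qed.

Lemma sqn_kernel_const (M : olct_param R) : sqn (kernel_const M) = (2 * pi * `|pb M|)^-1.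
Proof.
rewrite -cabs_sqr /cabs expr2 -ComplexField.Normc.normcM -expr2 /kernel_const sqr_sqrtc.
rewrite mul1r ComplexField.Normc.normcV !ComplexField.Normc.normcM /=.
rewrite !(expr0n, expr1n, addr0, add0r, sqrtr1, mulr1)/= !sqrtr_sqr.
by rewrite (ger0_norm (x := 2 * pi))// mulr_ge0// pi_ge0.
Qed.


Variable M : 'I_2 -> olct_param R.
Hypothesis b0 : forall r, pb (M r) != 0.
Local Notation lam1 := (pb (M 0))^-1.
Local Notation lam2 := (pb (M 1))^-1.

Definition chirp (t : R * R) : R := input_phase (M 0) t.1 + input_phase (M 1) t.2.
(** The chirp absorbs the phase of the kernel in t and preserves the modulus,
    which is all that the inequality depends on. *)
Definition chirped F (t : R * R) : R[i] := cis (chirp t) * F t.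

Lemma sqn_chirped F t : sqn (chirped F t) = sqn (F t).
Proof. by rewrite sqnM sqn_cis mul1r. Qed.

Lemma chirpedB F f t : chirped F t - chirped f t = cis (chirp t) * (F t - f t).
Proof. by rewrite mulrBr. Qed.

Lemma measurable_input_phase (N : olct_param R) :
  measurable_fun [set: T] (input_phase N : T -> R).
Proof.
apply: measurable_funM => //; apply: measurable_funD.
  by apply: measurable_funM => //; exact: measurable_funX.
exact: measurable_funM.
Qed.

Lemma measurable_output_phase (N : olct_param R) :
  measurable_fun [set: T] (output_phase N : T -> R).
Proof.
apply: measurable_funM => //; apply: measurable_funB.
  apply: measurable_funD => //.
  by apply: measurable_funM => //; exact: measurable_funX.
by apply: measurable_funM => //; exact: measurable_funM.
Qed.

Lemma measurable_chirp : measurable_fun [set: T * T] (chirp : T * T -> R).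
Proof.
apply: measurable_funD.
- exact: (measurableT_comp (measurable_input_phase (M 0)) measurable_fst).
- exact: (measurableT_comp (measurable_input_phase (M 1)) measurable_snd).
Qed.

Lemma chirped_Re F t :
  Re (chirped F t) = Re (F t) * cos (chirp t) - Im (F t) * sin (chirp t).
Proof. by rewrite /chirped /cis; case: (F t) => a b /=; ring. Qed.

Lemma chirped_Im F t :
  Im (chirped F t) = Re (F t) * sin (chirp t) + Im (F t) * cos (chirp t).
Proof. by rewrite /chirped /cis; case: (F t) => a b /=; ring. Qed.

Lemma integrable_chirped F : in_Lp 1 F ->
  itg2 (fun t => Re (chirped F t)) /\ itg2 (fun t => Im (chirped F t)).
Proof.
move=> /in_L1P[rF iF]; split.
- under eq_fun do rewrite chirped_Re.
  apply: integrable_EFinB.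
  + exact: (integrable2_cos rF measurable_chirp).
  + exact: (integrable2_sin iF measurable_chirp).
- under eq_fun do rewrite chirped_Im.
  apply: integrable_EFinD.
  + exact: (integrable2_sin rF measurable_chirp).
  + exact: (integrable2_cos iF measurable_chirp).
Qed.

Lemma measurable_chirped F : cmeasurable F ->
  measurable_fun [set: T * T] (fun t => Re (chirped F t)) /\
  measurable_fun [set: T * T] (fun t => Im (chirped F t)).
Proof.
move=> mF; have [mr mi] := (cmeasurable_Re mF, cmeasurable_Im mF).
have mc := measurable_cosF measurable_chirp.
have ms := measurable_sinF measurable_chirp.
split.
- under eq_fun do rewrite chirped_Re.
  by apply: measurable_funB; exact: measurable_funM.
- under eq_fun do rewrite chirped_Im.
  by apply: measurable_funD; exact: measurable_funM.
Qed.

Definition fourier2 F (u : R * R) : R[i] :=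
  (cfourier2 lam1 lam2 (fun t => Re (F t)) (fun t => Im (F t)) u +i*
   sfourier2 lam1 lam2 (fun t => Re (F t)) (fun t => Im (F t)) u)%C.

Lemma olct_integralE F u : in_Lp 1 F -> olct_integral M F u =
  kernel_const (M 0) * kernel_const (M 1) *
    cis (output_phase (M 0) u.1 + output_phase (M 1) u.2) * fourier2 (chirped F) u.
Proof.
move=> F1; have [rF iF] := integrable_chirped F1.
pose h t : R[i] := cis (- phase2 lam1 lam2 u t) * chirped F t.
have hR t : Re (h t) = Re (chirped F t) * cos (phase2 lam1 lam2 u t) +
    Im (chirped F t) * sin (phase2 lam1 lam2 u t).
  by rewrite /h /cis cosN sinN; case: (chirped F t) => a b /=; ring.
have hI t : Im (h t) = Im (chirped F t) * cos (phase2 lam1 lam2 u t) -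
    Re (chirped F t) * sin (phase2 lam1 lam2 u t).
  by rewrite /h /cis cosN sinN; case: (chirped F t) => a b /=; ring.
have rh : itg2 (fun t => Re (h t)).
  under eq_fun do rewrite hR.
  exact: (integrable_cfourier2 lam1 lam2 u rF iF).
have ih : itg2 (fun t => Im (h t)).
  under eq_fun do rewrite hI.
  exact: (integrable_sfourier2 lam1 lam2 u rF iF).
rewrite (_ : fourier2 (chirped F) u = cintegral h); last first.
  by rewrite /fourier2 /cintegral; congr (_ +i* _)%C;
    apply: eq_Rintegral => t _; rewrite ?hR ?hI.
rewrite -(cintegralZ _ rh ih) /olct_integral; congr cintegral; apply/funext => t.
rewrite !olct_kernelE// /h /chirped.
set k1 := kernel_const _; set k2 := kernel_const _.
set A1 := input_phase _ _; set A2 := input_phase _ _.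
set B1 := output_phase _ _; set B2 := output_phase _ _.
have -> : chirp t = A1 + A2 by [].
rewrite /phase2 !opprD !cisD.
set x1 := cis (- _); set x2 := cis (- _).
ring.
Qed.

Lemma sqn_olct_integral F u : in_Lp 1 F -> sqn (olct_integral M F u) =
  (2 * pi * `|pb (M 0)|)^-1 * (2 * pi * `|pb (M 1)|)^-1 * sqn (fourier2 (chirped F) u).
Proof.
by move=> F1; rewrite olct_integralE// !sqnM sqn_cis mulr1 !sqn_kernel_const.
Qed.

Lemma cmeasurableM F g : cmeasurable F -> cmeasurable g -> cmeasurable (fun t => F t * g t).
Proof.
move=> mF mg; have [rF iF] := (cmeasurable_Re mF, cmeasurable_Im mF).
have [rg ig] := (cmeasurable_Re mg, cmeasurable_Im mg); split.
- have : measurable_fun [set: T * T] (fun t => Re (F t) * Re (g t) - Im (F t) * Im (g t)).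
    by apply: measurable_funB; exact: measurable_funM.
  by congr measurable_fun; apply/funext => t; case: (F t) (g t) => [? ?] [].
- have : measurable_fun [set: T * T] (fun t => Re (F t) * Im (g t) + Im (F t) * Re (g t)).
    by apply: measurable_funD; exact: measurable_funM.
  by congr measurable_fun; apply/funext => t; case: (F t) (g t) => [? ?] [].
Qed.

Lemma cmeasurable_olct_integral F : in_Lp 1 F -> cmeasurable (olct_integral M F).
Proof.
move=> F1; have [rF iF] := integrable_chirped F1.
have -> : olct_integral M F = fun u => kernel_const (M 0) * kernel_const (M 1) *
    cis (output_phase (M 0) u.1 + output_phase (M 1) u.2) * fourier2 (chirped F) u.
  by apply/funext => u; exact: olct_integralE.
have mph : measurable_fun [set: T * T]
    (fun u : T * T => output_phase (M 0) u.1 + output_phase (M 1) u.2).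
  apply: measurable_funD.
  - exact: (measurableT_comp (measurable_output_phase (M 0)) measurable_fst).
  - exact: (measurableT_comp (measurable_output_phase (M 1)) measurable_snd).
apply: cmeasurableM.
  apply: cmeasurableM; first by split; exact: measurable_cst.
  by split; [exact: (measurable_cosF mph)|exact: (measurable_sinF mph)].
split.
- exact: (measurable_cfourier2 lam1 lam2 rF iF).
- exact: (measurable_sfourier2 lam1 lam2 rF iF).
Qed.

End complex_interface.

(** * The uncertainty inequality for the transform *)

Section olct_uncertainty.
Context {R : realType}.
Local Notation mu := (@lebesgue_measure R).
Local Notation mu2 := (@lebesgue_measure R \x @lebesgue_measure R)%E.
Local Notation T := (measurableTypeR R).
Local Notation itg2 f := (mu2.-integrable setT (EFin \o f)).
Local Notation Re := complex.Re.
Local Notation Im := complex.Im.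

Lemma measurable_coordinate (k : 'I_2) :
  measurable_fun [set: T * T] (coordinate k : T * T -> R).
Proof.
rewrite /coordinate; case: (k == 0).
- exact: measurable_fst.
- exact: measurable_snd.
Qed.

Lemma coordinate_ae_neq0 (k : 'I_2) : {ae mu2, forall t, coordinate k t != 0}.
Proof.
have m0 : measurable ([set 0] : set T) by exact: measurable_set1.
have mT : measurable ([set: T]) by exact: measurableT.
have mu0 : mu [set 0] = 0%E by exact: lebesgue_measure_set1.
rewrite /coordinate; case: (k == 0).
- exists ([set 0] `*` setT); split.
  + exact: measurableX.
  + by rewrite product_measure1E// [X in (X * _)%E]mu0 mul0e.
  + by move=> t /= /negP; rewrite negbK => /eqP.
- exists (setT `*` [set 0]); split.
  + exact: measurableX.
  + by rewrite product_measure1E// [X in (_ * X)%E]mu0 mule0.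
  + by move=> t /= /negP; rewrite negbK => /eqP.
Qed.

(** The coordinate axes are null sets. *)
Lemma moment_eq0 (k : 'I_2) (h : T * T -> R) : measurable_fun [set: T * T] h ->
  (forall t, 0 <= h t) ->
  (\int[mu2]_t (coordinate k t ^+ 2 * h t)%:E = 0)%E -> (\int[mu2]_t (h t)%:E = 0)%E.
Proof.
move=> mh h0 I0; have mx := measurable_coordinate k.
have mxh : measurable_fun [set: T * T] (fun t => coordinate k t ^+ 2 * h t).
  by apply: measurable_funM => //; exact: measurable_funX.
have xh0 t : 0 <= coordinate k t ^+ 2 * h t by rewrite mulr_ge0 ?sqr_ge0.
have A := integral_EFin_eq0 mxh xh0 I0.
rewrite -(integral0 mu2 setT); apply: ae_eq_integral => //.
  exact/measurable_EFinP.
apply: filterS2 A (coordinate_ae_neq0 k) => t /eqP + tk _.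
by rewrite mulf_eq0 expf_eq0/= (negbTE tk)/= => /eqP ->.
Qed.

Variable M : 'I_2 -> olct_param R.
Hypothesis b0 : forall r, pb (M r) != 0.
Local Notation lam1 := (pb (M 0))^-1.
Local Notation lam2 := (pb (M 1))^-1.
Local Notation K := (2 * pi / `|lam2| * (2 * pi / `|lam1|)).
Local Notation kappa := ((2 * pi * `|pb (M 0)|)^-1 * (2 * pi * `|pb (M 1)|)^-1).

Lemma kappa_gt0 : 0 < kappa.
Proof. by rewrite !mulr_gt0 ?invr_gt0 ?mulr_gt0 ?pi_gt0 ?normr_gt0. Qed.

(** kappa is the square modulus of the constant of the kernel, and K is the
    constant in Plancherel's inequality for the frequencies 1 / b: the transform
    is normalized to be isometric. *)
Lemma kappaK : kappa * K = 1.
Proof.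
have pi0 : @pi R != 0 by rewrite gt_eqF ?pi_gt0.
rewrite !normrV ?unitfE// !invrK; move: (@pi R) pi0 => p p0; field.
by rewrite !normr_eq0 !b0 p0.
Qed.

Lemma le_kappa_scale (X Y : \bar R) : (K%:E * X <= Y)%E -> (X <= kappa%:E * Y)%E.
Proof.
move=> XY; apply: (@le_trans _ _ (kappa%:E * (K%:E * X))%E).
  by rewrite muleA -EFinM kappaK mul1e.
by apply: lee_wpmul2l => //; rewrite lee_fin ltW// kappa_gt0.
Qed.

Variables (f Of : R * R -> R[i]).
Hypotheses (hf : in_Lp 2 f) (hOf : is_olct M f Of).

Let lam10 : lam1 != 0. Proof. by rewrite invr_eq0. Qed.
Let lam20 : lam2 != 0. Proof. by rewrite invr_eq0. Qed.

(** This excludes that the transform vanishes almost everywhere while f does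
    not. *)
Lemma olct_plancherel_le :
  (\int[mu2]_t (sqn (f t))%:E <= \int[mu2]_u (sqn (Of u))%:E)%E.
Proof.
have [gL2 [F [FL Fcv Ocv]]] := hOf.
have [mf mg] := (hf.1, gL2.1).
have mF n : cmeasurable (F n) by exact: (FL n).1.1.
have mO n := cmeasurable_olct_integral b0 (FL n).1.
apply: (@quadratic_limit _ _ _ _ _ mu2 mu2 _ _
  (fun n t => sqn (F n t)) (fun n t => sqn (f t - F n t))
  (fun n u => sqn (olct_integral M (F n) u))
  (fun n u => sqn (olct_integral M (F n) u - Of u))) => //.
- exact: measurable_sqn.
- by move=> n; exact: measurable_sqn.
- by move=> n; apply: measurable_sqn; exact: cmeasurableB.
- exact: measurable_sqn.
- by move=> n; exact: measurable_sqn.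
- by move=> n; apply: measurable_sqn; exact: cmeasurableB.
- by move=> t; exact: sqn_ge0.
- by move=> n t; exact: sqn_ge0.
- by move=> n t; exact: sqn_ge0.
- by move=> t; exact: sqn_ge0.
- by move=> n t; exact: sqn_ge0.
- by move=> n t; exact: sqn_ge0.
- by move=> eta n t eta0; exact: sqn_perturb.
- by move=> eta n t eta0; exact: sqn_perturb.
- move=> n; have [rF iF] := integrable_chirped M (FL n).1.
  under eq_integral do rewrite -(sqn_chirped M).
  under [leRHS]eq_integral do rewrite (sqn_olct_integral b0 _ (FL n).1).
  rewrite integral_EFinZ.
  + by apply: le_kappa_scale; exact: (plancherel2_le lam10 lam20 rF iF).
  + apply: measurable_funD; apply: measurable_funX.
      exact: (measurable_cfourier2 lam1 lam2 rF iF).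
    exact: (measurable_sfourier2 lam1 lam2 rF iF).
  + by move=> u; exact: sqn_ge0.
  + exact/ltW/kappa_gt0.
- move=> e e0; apply: filterS (Lpnorm2_cvg0 Fcv e0) => n.
  by congr (_ <= _)%E; apply: eq_integral => t _; congr EFin;
    case: (F n t) (f t) => [? ?] [? ?]; rewrite /sqn /=; ring.
- by move=> e e0; exact: (Lpnorm2_cvg0 Ocv e0).
Qed.

(** The estimate [displacement_le] for the approximating functions, in the
    limit. *)
Lemma olct_displacement_le (v : R * R) :
  (\int[mu2]_t (sqn (chirped M f (t + v) - chirped M f t))%:E <=
   \int[mu2]_u ((2 - 2 * cos (phase2 lam1 lam2 u v)) * sqn (Of u))%:E)%E.
Proof.
have [gL2 [F [FL Fcv Ocv]]] := hOf.
have [mf mg] := (hf.1, gL2.1).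
have mF n : cmeasurable (F n) by exact: (FL n).1.1.
have mO n := cmeasurable_olct_integral b0 (FL n).1.
pose w u := 2 - 2 * cos (phase2 lam1 lam2 u v).
have w0 u : 0 <= w u by rewrite /w; have := cos_le1 (phase2 lam1 lam2 u v); lra.
have w4 u : w u <= 4 by rewrite /w; have := cos_geN1 (phase2 lam1 lam2 u v); lra.
have mw : measurable_fun [set: T * T] w.
  apply: measurable_funB => //; apply: measurable_funM => //.
  apply: measurable_cosF; apply: measurable_funD; apply: measurable_funM => //.
  - by apply: measurable_funM.
  - by apply: measurable_funM.
have shift G : cmeasurable G -> cmeasurable (fun t => G (t + v)).
  move=> mG; split.
  - exact: (measurableT_comp (cmeasurable_Re mG) (measurable_translation2 v)).
  - exact: (measurableT_comp (cmeasurable_Im mG) (measurable_translation2 v)).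
have mch G : cmeasurable G -> cmeasurable (chirped M G).
  by move=> mG; have [] := measurable_chirped M mG.
have md G : cmeasurable G -> cmeasurable (fun t => chirped M G (t + v) - chirped M G t).
  by move=> mG; apply: cmeasurableB; [apply: shift|]; exact: mch.
have mD n : cmeasurable (fun t => F n t - f t) by exact: cmeasurableB.
have msD n : measurable_fun [set: T * T] (fun t => sqn (F n t - f t)).
  exact: measurable_sqn (mD n).
have msDv n : measurable_fun [set: T * T] (fun t => sqn (F n (t + v) - f (t + v))).
  exact: measurable_sqn (shift _ (mD n)).
apply: (@quadratic_limit _ _ _ _ _ mu2 mu2 _ (fun u => w u * sqn (Of u))
  (fun n t => sqn (chirped M (F n) (t + v) - chirped M (F n) t))
  (* the error of a difference of two values is at most twice the sum of their errors *)
  (fun n t => 2 * sqn (F n (t + v) - f (t + v)) + 2 * sqn (F n t - f t))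
  (fun n u => w u * sqn (olct_integral M (F n) u))
  (fun n u => 4 * sqn (olct_integral M (F n) u - Of u))).
- exact: measurable_sqn (md _ mf).
- by move=> n; exact: measurable_sqn (md _ (mF n)).
- by move=> n; apply: measurable_funD; exact: measurable_funM.
- by apply: measurable_funM => //; exact: measurable_sqn.
- by move=> n; apply: measurable_funM => //; exact: measurable_sqn.
- by move=> n; apply: measurable_funM => //; apply: measurable_sqn; exact: cmeasurableB.
- by move=> t; exact: sqn_ge0.
- by move=> n t; exact: sqn_ge0.
- by move=> n t; rewrite addr_ge0 ?mulr_ge0 ?sqn_ge0.
- by move=> u; rewrite mulr_ge0 ?sqn_ge0.
- by move=> n u; rewrite mulr_ge0 ?sqn_ge0.
- by move=> n u; rewrite mulr_ge0 ?sqn_ge0.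
- move=> eta n t eta0.
  apply: le_trans (sqn_perturb _ (chirped M (F n) (t + v) - chirped M (F n) t) eta0) _.
  rewrite lerD2l ler_wpM2l ?addr_ge0 ?invr_ge0 ?(ltW eta0)//.
  have -> : chirped M f (t + v) - chirped M f t -
      (chirped M (F n) (t + v) - chirped M (F n) t) =
      (chirped M (F n) t - chirped M f t) -
      (chirped M (F n) (t + v) - chirped M f (t + v)) by ring.
  apply: le_trans (sqnB_le _ _) _.
  by rewrite !chirpedB !sqnM !sqn_cis !mul1r addrC.
- move=> eta n u eta0.
  apply: (@le_trans _ _ (w u * ((1 + eta) * sqn (Of u) +
      (1 + eta^-1) * sqn (olct_integral M (F n) u - Of u)))).
    by rewrite ler_wpM2l// sqn_perturb.
  rewrite mulrDr mulrCA lerD2l mulrCA ler_wpM2l ?addr_ge0 ?invr_ge0 ?(ltW eta0)//.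
  by rewrite ler_wpM2r// sqn_ge0.
- move=> n; have [rF iF] := integrable_chirped M (FL n).1.
  have -> : (\int[mu2]_u (w u * sqn (olct_integral M (F n) u))%:E =
      \int[mu2]_u (kappa * (w u * sqn (fourier2 M (chirped M (F n)) u)))%:E)%E.
    apply: eq_integral => u _; congr EFin.
    by rewrite (sqn_olct_integral b0 _ (FL n).1) mulrCA.
  rewrite integral_EFinZ.
  + apply: le_kappa_scale.
    apply: le_trans (displacement_le lam10 lam20 v rF iF).
    apply: lee_wpmul2l.
      by rewrite lee_fin mulr_ge0 ?divr_ge0 ?mulr_ge0 ?pi_ge0.
    rewrite le_eqVlt; apply/orP; left; apply/eqP; apply: eq_integral => t _; congr EFin.
    by rewrite /sqn; case: (chirped M (F n) (t + v)) (chirped M (F n) t) => [? ?] [].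
  + apply: measurable_funM => //; apply: measurable_funD; apply: measurable_funX.
      exact: (measurable_cfourier2 lam1 lam2 rF iF).
    exact: (measurable_sfourier2 lam1 lam2 rF iF).
  + by move=> u; rewrite mulr_ge0 ?sqn_ge0.
  + exact/ltW/kappa_gt0.
- move=> e e0; have e4 : 0 < e / 4 by rewrite divr_gt0.
  apply: filterS (Lpnorm2_cvg0 Fcv e4) => n ne.
  rewrite integral_EFinD; first last.
  + by move=> t; rewrite mulr_ge0 ?sqn_ge0.
  + by move=> t; rewrite mulr_ge0 ?sqn_ge0.
  + exact: measurable_funM.
  + exact: measurable_funM.
  have ns t : 0 <= sqn (F n t - f t) by exact: sqn_ge0.
  have ns' t : 0 <= sqn (F n (t + v) - f (t + v)) by exact: sqn_ge0.
  have n2 : 0 <= 2 :> R by [].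
  rewrite (integral_EFinZ mu2 (msDv n) ns' n2) (integral_EFinZ mu2 (msD n) ns n2).
  rewrite (ge0_integral2_translation v (msD n) ns).
  apply: (@le_trans _ _ (2%:E * (e / 4)%:E + 2%:E * (e / 4)%:E)%E).
    by apply: leeD; apply: lee_wpmul2l; rewrite ?lee_fin.
  rewrite -!EFinM -EFinD lee_fin; lra.
- move=> e e0; have e4 : 0 < e / 4 by rewrite divr_gt0.
  apply: filterS (Lpnorm2_cvg0 Ocv e4) => n ne.
  rewrite integral_EFinZ//.
  + apply: (@le_trans _ _ (4%:E * (e / 4)%:E)%E).
      by apply: lee_wpmul2l; rewrite ?lee_fin.
    rewrite -EFinM lee_fin; lra.
  + by apply: measurable_sqn; exact: cmeasurableB.
  + by move=> u; exact: sqn_ge0.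
Qed.

Definition step (k : 'I_2) (s : R) : R * R := if k == 0 then (s, 0) else (0, s).

Lemma coordinate_step k t s : coordinate k (t + step k s) = coordinate k t + s.
Proof. by rewrite /coordinate /step; case: (k == 0). Qed.

Lemma phase2_step k u s : phase2 lam1 lam2 u (step k s) = coordinate k u * s / pb (M k).
Proof.
have [->|->] : k = 0 \/ k = 1.
  by case: k => -[|[|//]] i; [left|right]; exact: val_inj.
- by rewrite /phase2 /coordinate /step /=; ring.
- by rewrite /phase2 /coordinate /step /=; ring.
Qed.

Lemma olct_displacement_moment k s :
  (\int[mu2]_t (sqn (chirped M f (t + step k s) - chirped M f t))%:E <=
   (s ^+ 2 / pb (M k) ^+ 2)%:E *
     \int[mu2]_u (coordinate k u ^+ 2 * sqn (Of u))%:E)%E.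
Proof.
apply: le_trans (olct_displacement_le _) _.
have mg := hOf.1.1; have ms := measurable_sqn mg; have mx := measurable_coordinate k.
have mxs : measurable_fun [set: T * T] (fun u => coordinate k u ^+ 2 * sqn (Of u)).
  by apply: measurable_funM => //; exact: measurable_funX.
rewrite -integral_EFinZ//; first last.
- by rewrite divr_ge0 ?sqr_ge0.
- by move=> u; rewrite mulr_ge0 ?sqr_ge0 ?sqn_ge0.
apply: le_integral_EFin.
- apply: measurable_funM => //; apply: measurable_funB => //; apply: measurable_funM => //.
  apply: measurable_cosF; apply: measurable_funD; apply: measurable_funM => //.
  - by apply: measurable_funM.
  - by apply: measurable_funM.
- exact: measurable_funM.
- move=> u; apply: mulr_ge0; last exact: sqn_ge0.
  by have := cos_le1 (phase2 lam1 lam2 u (step k s)); lra.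
- move=> u; rewrite mulrA ler_wpM2r ?sqn_ge0//.
  apply: le_trans (chord_le_arc _) _; rewrite phase2_step.
  rewrite le_eqVlt; apply/orP; left; apply/eqP.
  by field; rewrite b0.
Qed.

(** If f does not vanish almost everywhere, then both second moments are
    positive: the first by [moment_eq0], the second also by
    [olct_plancherel_le].  If one of them is infinite, so is the product; if
    both are finite, [translation_uncertainty] applies with
    E = U / b_k ^ 2. *)
Lemma olct_uncertainty k :
  (((pb (M k) / 2) ^+ 2)%:E *
    (\int[mu2]_t (sqn (f t))%:E * \int[mu2]_t (sqn (f t))%:E) <=
   \int[mu2]_u (coordinate k u ^+ 2 * sqn (Of u))%:E *
   \int[mu2]_t (coordinate k t ^+ 2 * sqn (f t))%:E)%E.
Proof.
have [mf mg] := (hf.1, hOf.1.1).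
have [msf msg] := (measurable_sqn mf, measurable_sqn mg).
have mx := measurable_coordinate k.
have mx2 : measurable_fun [set: T * T] (fun t => coordinate k t ^+ 2).
  exact: measurable_funX.
have mU : measurable_fun [set: T * T] (fun u => coordinate k u ^+ 2 * sqn (Of u)).
  exact: measurable_funM.
have mD : measurable_fun [set: T * T] (fun t => coordinate k t ^+ 2 * sqn (f t)).
  exact: measurable_funM.
have fp t : 0 <= sqn (f t) by exact: sqn_ge0.
have gp t : 0 <= sqn (Of t) by exact: sqn_ge0.
have Up u : 0 <= coordinate k u ^+ 2 * sqn (Of u) by rewrite mulr_ge0 ?sqr_ge0.
have Dp t : 0 <= coordinate k t ^+ 2 * sqn (f t) by rewrite mulr_ge0 ?sqr_ge0.
have U0 := integral_EFin_ge0 mu2 Up; have D0 := integral_EFin_ge0 mu2 Dp.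
have N0 := integral_EFin_ge0 mu2 fp.
have Nfin := in_L2P hf.
have [Nz|Nn0] := eqVneq (\int[mu2]_t (sqn (f t))%:E)%E 0%E.
  by rewrite Nz mul0e mule0 mule_ge0.
have Dn0 : (\int[mu2]_t (coordinate k t ^+ 2 * sqn (f t))%:E != 0)%E.
  by apply: contra_neq Nn0; exact: moment_eq0.
have Un0 : (\int[mu2]_u (coordinate k u ^+ 2 * sqn (Of u))%:E != 0)%E.
  apply: contra_neq Nn0 => /(moment_eq0 msg gp) g0.
  by apply/eqP; rewrite eq_le N0 andbT -g0; exact: olct_plancherel_le.
have [Uy|Uy] := eqVneq (\int[mu2]_u (coordinate k u ^+ 2 * sqn (Of u))%:E)%E +oo%E.
  by rewrite Uy gt0_mulye ?leey// lt_neqAle eq_sym Dn0.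
have [Dy|Dy] := eqVneq (\int[mu2]_t (coordinate k t ^+ 2 * sqn (f t))%:E)%E +oo%E.
  by rewrite Dy gt0_muley ?leey// lt_neqAle eq_sym Un0.
have iD : itg2 (fun t => coordinate k t ^+ 2 * sqn (f t)).
  by apply: integrable_lt => //; rewrite lt_neqAle Dy leey.
have iU : itg2 (fun t => coordinate k t ^+ 2 * sqn (Of t)).
  by apply: integrable_lt => //; rewrite lt_neqAle Uy leey.
have iN : itg2 (fun t => sqn (f t)) by exact: integrable_lt.
have [mP mQ] := measurable_chirped M mf.
have wE t : Re (chirped M f t) ^+ 2 + Im (chirped M f t) ^+ 2 = sqn (f t).
  exact: sqn_chirped.
pose U := \int[mu2]_u (coordinate k u ^+ 2 * sqn (Of u)).
have U0' : 0 <= U by apply: Rintegral_ge0 => u _; exact: Up.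
have E0 : 0 <= U / pb (M k) ^+ 2 by rewrite divr_ge0 ?sqr_ge0.
have iw : itg2 (fun t => Re (chirped M f t) ^+ 2 + Im (chirped M f t) ^+ 2).
  by under eq_fun do rewrite wE.
have ixw : itg2 (fun t => coordinate k t ^+ 2 *
    (Re (chirped M f t) ^+ 2 + Im (chirped M f t) ^+ 2)).
  by under eq_fun do rewrite wE.
have dsp s : 0 < s -> (\int[mu2]_t
    ((Re (chirped M f (t + step k s)) - Re (chirped M f t)) ^+ 2 +
     (Im (chirped M f (t + step k s)) - Im (chirped M f t)) ^+ 2)%:E <=
    (s ^+ 2 * (U / pb (M k) ^+ 2))%:E)%E.
  move=> _; have := olct_displacement_moment k s.
  rewrite (EFin_Rintegral iU) -EFinM -/U.
  rewrite (_ : s ^+ 2 / pb (M k) ^+ 2 * U = s ^+ 2 * (U / pb (M k) ^+ 2)); last by ring.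
  congr (_ <= _)%E; apply: eq_integral => t _; congr EFin.
  by case: (chirped M f (t + step k s)) (chirped M f t) => [? ?] [].
have H := translation_uncertainty mP mQ mx (coordinate_step k) iw ixw E0 dsp.
rewrite (EFin_Rintegral iU) (EFin_Rintegral iD) (EFin_Rintegral iN) -!EFinM lee_fin.
move: H; under eq_Rintegral do rewrite wE.
under [X in _ <= 4 * X * _]eq_Rintegral do rewrite wE.
rewrite -/U; set N := Rintegral _ _ _; set D := Rintegral _ _ _ => H.
have b2 : 0 < pb (M k) ^+ 2 by rewrite exprn_even_gt0//= b0.
rewrite -expr2 expr_div_n.
rewrite (_ : U * D = pb (M k) ^+ 2 / 2 ^+ 2 * (4 * D * (U / pb (M k) ^+ 2))).
  by rewrite ler_wpM2l// divr_ge0 ?sqr_ge0.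
by field; rewrite b0.
Qed.

End olct_uncertainty.

Theorem theorem3p7 (R : realType) (M : 'I_2 -> olct_param R)
  (hdet : forall r, pa (M r) * pd (M r) - pb (M r) * pc (M r) = 1)
  (hb : forall r, pb (M r) != 0)
  (m n : nat) (f Of : R * R -> R[i])
  (hf : in_Lp 2 f)
  (hD : distrib_in_L2 (Dop M m n (regular_distrib f)))
  (hOf : is_olct M f Of) (k : 'I_2) :
  ((\int[mu2 R]_u ((`|coordinate k u| ^+ 2 * cabs (Of u) ^+ 2)%R)%:E) *
   (\int[mu2 R]_t ((`|coordinate k t| ^+ 2 * cabs (f t) ^+ 2)%R)%:E)
   >= ((`|pb (M k) / 2| ^+ 2)%R)%:E * Lpnorm 2 f ^+ 4)%E.
Proof.
rewrite real_normK ?num_real//.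
have -> : (Lpnorm 2 f ^+ 4 = Lpnorm 2 f * Lpnorm 2 f * (Lpnorm 2 f * Lpnorm 2 f))%E.
  by rewrite !expeS expe0 mule1 !muleA.
rewrite !Lpnorm2E.
under [X in (_ <= X * _)%E]eq_integral do rewrite real_normK ?num_real// cabs_sqr.
under [X in (_ <= _ * X)%E]eq_integral do rewrite real_normK ?num_real// cabs_sqr.
exact: (olct_uncertainty hb hf hOf k).
Qed.
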